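(* Let $p\ge 2$ be an integer. Let $F:\mathbb{R}^d\to\mathbb{R}^d$ be monotone and $p-1$ times continuously differentiable with $\|D^{p-1}F(z)-D^{p-1}F(z')\|_{\mathrm{op}}\le L_p\|z-z'\|$ for all $z,z'\in\mathbb{R}^d$, where $L_p>0$; let $H:\mathbb{R}^d\rightrightarrows\mathbb{R}^d$ be maximally monotone, and let $z^*$ satisfy $0\in F(z^* )+H(z^* )$. Let $z_0\in\operatorname{dom}(H)$ and $\varepsilon>0$. Consider the AEP Tensor method (defined in the context). At every outer iteration $k$ before termination, the line search returns after $$\mathcal{O}_p\left(1+\log\left(1+\frac{L_p\|z_0-z^*\|^p}{\varepsilon}\right)\right)$$ trial evaluations, including the initial trial at $a=\bar a_k$, where the constant hidden in $\mathcal{O}_p$ depends only on $p$.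
   Context: Norms are Euclidean; $\|\cdot\|_{\mathrm{op}}$ is the induced (multilinear) operator norm. $\operatorname{dom}(H)=\{z:H(z)\ne\emptyset\}$. Regularized Taylor model. Put $\lambda=L_p$, $M_p=L_p+p\lambda=(p+1)L_p$, $\rho=1/\sqrt2$, and $$T_\lambda^{(p-1)}(z';z)=F(z)+\sum_{i=1}^{p-1}\frac1{i!}D^iF(z)[z'-z]^i+\frac{\lambda}{(p-1)!}\|z'-z\|^{p-1}(z'-z).$$ For $\lambda\ge L_p$ the map $T_\lambda^{(p-1)}(\cdot;z)$ is maximal monotone with domain $\mathbb{R}^d$ (known fact), so the subproblem below has a unique solution. AEP Tensor method. Input: $p$, $z_0\in\operatorname{dom}(H)$, $\varepsilon>0$, $L_p$. Choose $v_0\in H(z_0)$ and set $A_0=0$. For $k=0,1,2,\dots$: (1) If $\|F(z_k)+v_k\|\le\varepsilon$, stop and return $z_k$. (2) Otherwise run the line search. For a trial step size $a>0$, a trial evaluation consists of computing $$z_{k+1/2}(a)=\frac{a}{A_k+a}z_0+\frac{A_k}{A_k+a}\bigl(z_k-a(F(z_k)+v_k)\bigr),\qquad P_{k,a}(z)=T_\lambda^{(p-1)}(z;z_{k+1/2}(a)),$$ the unique solution $z_{k+1}(a)$ of $$0\in aP_{k,a}(z_{k+1}(a))+aH(z_{k+1}(a))+z_{k+1}(a)-\Bigl(\frac{a}{A_k+a}z_0+\frac{A_k}{A_k+a}z_k\Bigr),$$ and $$v_{k+1}(a)=\frac1a\Bigl(\frac{a}{A_k+a}z_0+\frac{A_k}{A_k+a}z_k-z_{k+1}(a)\Bigr)-P_{k,a}(z_{k+1}(a))\in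 H(z_{k+1}(a)).$$ The merit function is $\psi_k(a)=M_p\,a\,\|z_{k+1}(a)-z_{k+1/2}(a)\|^{p-1}$ for $a>0$, $\psi_k(0)=0$. The upper trial value is $$\bar a_k=\max\left\{\frac{2A_k\|F(z_k)+v_k\|}{\varepsilon},\ \left(\frac{2(1+\rho)}{\varepsilon}\Bigl(\frac{p!\rho}{M_p}\Bigr)^{1/(p-1)}\right)^{(p-1)/p}\right\}.$$ First evaluate the trial $a=\bar a_k$. If $\psi_k(\bar a_k)\le p!\rho$, the whole method terminates and returns $z_{k+1}(\bar a_k)$ (this counts as the line search returning). Otherwise set $a^-=0$, $a^+=\bar a_k$ and repeat (bisection phase): evaluate the trial $a=(a^-+a^+)/2$; if $\psi_k(a)<p!\rho/\sqrt2=p!/2$ set $a^-\leftarrow a$; if $\psi_k(a)>p!\rho=p!/\sqrt2$ set $a^+\leftarrow a$; otherwise accept $a_k=a$, and the line search returns. (3) After acceptance set $z_{k+1/2}=z_{k+1/2}(a_k)$, $z_{k+1}=z_{k+1}(a_k)$, $v_{k+1}=v_{k+1}(a_k)$, $A_{k+1}=A_k+a_k$. ''Outer iteration $k$ before termination'' means that iteration $k$ is reached and the line search in step (2) is invoked there. *)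

(* Defs.v *)
From HB Require Import structures.
From mathcomp Require Import all_boot all_order all_algebra.
From mathcomp Require Import all_classical all_reals all_analysis.

Set Implicit Arguments.
Unset Strict Implicit.
Unset Printing Implicit Defensive.

Import Order.TTheory GRing.Theory Num.Theory.
Import numFieldNormedType.Exports.

Local Open Scope classical_set_scope.
Local Open Scope ring_scope.

Section Euclidean.
Context {R : realType} {d : nat}.
Notation V := 'rV[R]_d.

Definition dot (x y : V) : R := \sum_(i < d) x ord0 i * y ord0 i.

(* The library norm on 'rV[R]_d is the sup norm; it only serves to define
   derivatives and continuity, which do not depend on the choice of norm. *)
Definition enorm (x : V) : R := Num.sqrt (dot x x).

(* Meant for multilinear M. The supremum is taken in \bar R so that it is never
   the default value that sup assigns to an unbounded set. *)
Definition op_norm (m : nat) (M : m.-tuple V -> V) : \bar R :=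
  ereal_sup [set (enorm (M hs))%:E |
              hs in [set hs | forall i, enorm (tnth hs i) <= 1]].

(* iter_diff F [:: h1; ...; hi] z is D^i F(z)[h1, ..., hi]: the derivative at z,
   in direction h1, of the map w |-> D^(i-1) F(w)[h2, ..., hi]. *)
Fixpoint iter_diff (F : V -> V) (hs : seq V) : V -> V :=
  if hs is h :: hs' then fun z => 'd (iter_diff F hs') z h else F.

(* In finite dimension a multilinear-map-valued function is differentiable
   (resp. continuous) iff its evaluation at each fixed list of vectors is. *)
Definition continuously_differentiable (n : nat) (F : V -> V) : Prop :=
  (forall hs, (size hs < n)%N -> forall z, differentiable (iter_diff F hs) z) /\
  (forall hs, (size hs <= n)%N -> continuous (iter_diff F hs)).

(* A set-valued operator is given by its graph: H z v means v \in H(z). *)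
Definition monotone_op (H : V -> set V) : Prop :=
  forall x y u v, H x u -> H y v -> 0 <= dot (u - v) (x - y).

Definition maximal_monotone (H : V -> set V) : Prop :=
  monotone_op H /\
  forall G : V -> set V, monotone_op G -> (forall x, H x `<=` G x) ->
    forall x, G x `<=` H x.

Definition dom (H : V -> set V) : set V := [set z | H z !=set0].

End Euclidean.

Section AEPTensor.
Context {R : realType} {d : nat}.
Notation V := 'rV[R]_d.

Variables (p : nat) (F : V -> V) (H : V -> set V) (L eps : R) (z0 : V).

(* T_lambda^(p-1)(z'; z) *)
Definition taylor_model (lambda : R) (z' z : V) : V :=
  F z
  + \sum_(1 <= i < p) (i`!%:R)^-1 *: iter_diff F (nseq i (z' - z)) z
  + (lambda / (p.-1)`!%:R * enorm (z' - z) ^+ p.-1) *: (z' - z).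

Definition lambda : R := L.
Definition Mp : R := L + p%:R * lambda.
Definition rho : R := (Num.sqrt 2)^-1.

Record state := State { st_z : V; st_v : V; st_A : R }.

Definition residual (s : state) : R := enorm (F (st_z s) + st_v s).

Definition anchor (s : state) (a : R) : V :=
  (a / (st_A s + a)) *: z0 + (st_A s / (st_A s + a)) *: st_z s.

Definition z_half (s : state) (a : R) : V :=
  (a / (st_A s + a)) *: z0
  + (st_A s / (st_A s + a)) *: (st_z s - a *: (F (st_z s) + st_v s)).

Definition P_model (s : state) (a : R) (z : V) : V :=
  taylor_model lambda z (z_half s a).

Definition subproblem (s : state) (a : R) : set V :=
  [set z | exists2 v, H z v &
             a *: P_model s a z + a *: v + z - anchor s a = 0].

(* The unique solution of the subproblem. Unique solvability is not assumed:
   xget would return the dummy value 0 if there were no solution. *)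
Definition z_next (s : state) (a : R) : V := xget 0 (subproblem s a).

Definition v_next (s : state) (a : R) : V :=
  a^-1 *: (anchor s a - z_next s a) - P_model s a (z_next s a).

Definition merit (s : state) (a : R) : R :=
  Mp * a * enorm (z_next s a - z_half s a) ^+ p.-1.

Definition upper_trial (s : state) : R :=
  Num.max (2 * st_A s * residual s / eps)
    ((2 * (1 + rho) / eps * (p`!%:R * rho / Mp) `^ (p.-1%:R^-1))
       `^ (p.-1%:R / p%:R)).

Definition mid (lo hi : R) : R := (lo + hi) / 2.

(* bisection s lo hi n a: started from the bracket (lo, hi), the bisection phase
   accepts the step size a at its n-th trial evaluation. *)
Inductive bisection (s : state) (lo hi : R) : nat -> R -> Prop :=
| Bisection_accept of
    p`!%:R * rho / Num.sqrt 2 <= merit s (mid lo hi) <= p`!%:R * rho :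
    bisection s lo hi 1 (mid lo hi)
| Bisection_raise n a of
    merit s (mid lo hi) < p`!%:R * rho / Num.sqrt 2 &
    bisection s (mid lo hi) hi n a :
    bisection s lo hi n.+1 a
| Bisection_lower n a of
    p`!%:R * rho < merit s (mid lo hi) &
    bisection s lo (mid lo hi) n a :
    bisection s lo hi n.+1 a.

Inductive outcome :=
| Terminate of V
| Accept of R.

(* line_search s n o: the line search invoked at s returns with outcome o after
   exactly n trial evaluations, the initial one included. *)
Inductive line_search (s : state) : nat -> outcome -> Prop :=
| Line_search_terminate of merit s (upper_trial s) <= p`!%:R * rho :
    line_search s 1 (Terminate (z_next s (upper_trial s)))
| Line_search_bisect n a of
    p`!%:R * rho < merit s (upper_trial s) &
    bisection s 0 (upper_trial s) n a :
    line_search s n.+1 (Accept a).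

Definition next_state (s : state) (a : R) : state :=
  State (z_next s a) (v_next s a) (st_A s + a).

(* line_search_invoked k s: outer iteration k is reached with
   s = (z_k, v_k, A_k) and does not stop in step (1). *)
Inductive reached : nat -> state -> Prop :=
| Reached_init v0 of H z0 v0 : reached 0 (State z0 v0 0)
| Reached_next k s n a of
    line_search_invoked k s & line_search s n (Accept a) :
    reached k.+1 (next_state s a)
with line_search_invoked : nat -> state -> Prop :=
| Invoked k s of reached k s & eps < residual s : line_search_invoked k s.

End AEPTensor.

(* Main.v *)
(** Write q = p - 1 and D = |z0 - zstar|. The Taylor model with center h differs
    from F at x by at most a multiple of L |x - h|^p, it is monotone (its
    derivative is within a multiple of L |x - h|^q of that of F, and the
    regularizer compensates), and it is Lipschitz in h. Minty's theorem, applied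
    to the sum of H and the model, shows that trial points exist, and trial
    points depend nonexpansively on the data of the subproblem.

    Accepted steps never increase the energy A <w, z - z0> + A^2 |w|^2 / 2, where
    w = F z + v; the decrease also controls the errors of the inexact steps.
    Hence A |w| <= 2 D and |z - zstar| <= 2 D at every iteration.

    It follows that the radius |z_(k+1)(a) - z_(k+1/2)(a)| is of order at most
    D (1 + a L D^q) and is Lipschitz in the step size a. A bracket whose end
    points have merits below p!/2 and above p!/sqrt 2 is therefore not narrower
    than 1 / (L D^q) divided by a power of 1 + kappa, kappa = L D^p / eps, while
    the upper trial value is of order at most (1 + kappa) / (L D^q). So bisection
    stops after O(1 + log (1 + kappa)) trials. *)

Require Import Defs.
From mathcomp Require Import all_boot all_order all_algebra.
From mathcomp Require Import all_classical all_reals all_analysis.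
From mathcomp Require Import ring lra.
Import Order.TTheory GRing.Theory Num.Theory.
Import numFieldNormedType.Exports.
Local Open Scope classical_set_scope.
Local Open Scope ring_scope.
Set Implicit Arguments.
Unset Strict Implicit.
Unset Printing Implicit Defensive.

(** * Euclidean norm *)

(** The argument does not rely on monotonicity of the merit in the step size: a bracket is known
    only through its end values. The two thresholds differ by at least 1/5, and a modulus of
    continuity of the merit turns this into a lower bound on the width. The obstacle is that no
    positive lower bound on A is available, so the weight a / (A + a) is not uniformly Lipschitz
    near 0. Its variation over [a, b] is however at most (b - a) / b, whatever A is; hence the
    estimates use this relative width and assume b <= 2 a. A bracket with b > 2 a is longer than b /
    2, and b is not small, since a merit above the threshold forces X b = b L D^q to exceed a
    constant. X and kappa are dimensionless, which is why the constants depend on p only. If D = 0,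
    then X = 0 and the initial trial already terminates. The value rho = 1 / sqrt 2 links acceptance
    to the energy: a merit at most p! rho bounds a times the model error by rho times the radius,
    and 2 rho^2 = 1 is exactly what the energy identity absorbs. *)

Lemma cvg_sum_ord {R : realType} {W : normedModType R} {T : Type}
  {F : set_system T} {FF : Filter F} n (f : 'I_n -> T -> W) (a : 'I_n -> W) :
  (forall i, f i x @[x --> F] --> a i) ->
  \sum_(i < n) f i x @[x --> F] --> \sum_(i < n) a i.
Proof. by move=> h; apply: cvg_big => // z; exact: add_continuous. Qed.

Section EuclideanSpace.
Context {R : realType} {d : nat}.
Notation V := 'rV[R]_d.
Implicit Types (x y z : V) (c : R).

Lemma dotC x y : dot x y = dot y x.
Proof. by apply: eq_bigr => i _; rewrite mulrC. Qed.

Lemma dotDl x y z : dot (x + y) z = dot x z + dot y z.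
Proof. by rewrite -big_split; apply: eq_bigr => i _; rewrite mxE mulrDl. Qed.

Lemma dotZl c x y : dot (c *: x) y = c * dot x y.
Proof. by rewrite /dot mulr_sumr; apply: eq_bigr => i _; rewrite mxE mulrA. Qed.

Lemma dotDr x y z : dot x (y + z) = dot x y + dot x z.
Proof. by rewrite dotC dotDl !(dotC x). Qed.

Lemma dotZr c x y : dot x (c *: y) = c * dot x y.
Proof. by rewrite dotC dotZl (dotC x). Qed.

Lemma dotNl x y : dot (- x) y = - dot x y.
Proof. by rewrite -scaleN1r dotZl mulN1r. Qed.

Lemma dotNr x y : dot x (- y) = - dot x y.
Proof. by rewrite dotC dotNl (dotC x). Qed.

Lemma dotBl x y z : dot (x - y) z = dot x z - dot y z.
Proof. by rewrite dotDl dotNl. Qed.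

Lemma dotBr x y z : dot x (y - z) = dot x y - dot x z.
Proof. by rewrite dotDr dotNr. Qed.

Lemma dot0l x : dot 0 x = 0.
Proof. by rewrite -[X in dot X _](scale0r x) dotZl mul0r. Qed.

Lemma dot0r x : dot x 0 = 0.
Proof. by rewrite dotC dot0l. Qed.

Definition dotE := (dotDl, dotDr, dotNl, dotNr, dotZl, dotZr).

Lemma dot_suml (I : Type) (r : seq I) (P : pred I) (f : I -> V) y :
  dot (\sum_(i <- r | P i) f i) y = \sum_(i <- r | P i) dot (f i) y.
Proof.
by apply: (big_morph (dot^~ y)) => [u v|]; [exact: dotDl|exact: dot0l].
Qed.

Lemma dot_ge0 x : 0 <= dot x x.
Proof. by apply: sumr_ge0 => i _; rewrite -expr2 sqr_ge0. Qed.

Lemma enorm_ge0 x : 0 <= enorm x. Proof. exact: sqrtr_ge0. Qed.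

Lemma enorm_sqr x : enorm x ^+ 2 = dot x x.
Proof. by rewrite sqr_sqrtr// dot_ge0. Qed.

Lemma enorm_le x c : 0 <= c -> (enorm x <= c) = (dot x x <= c ^+ 2).
Proof. by move=> c0; rewrite -enorm_sqr ler_sqr// nnegrE// enorm_ge0. Qed.

Lemma dot_eq0 x : dot x x = 0 -> x = 0.
Proof.
move=> /eqP; rewrite psumr_eq0 => [/allP x0|i _]; last by rewrite -expr2 sqr_ge0.
apply/rowP => i; rewrite mxE; apply/eqP.
by have := x0 i (mem_index_enum i); rewrite mulf_eq0 orbb.
Qed.

Lemma enorm0 : enorm (0 : V) = 0.
Proof. by rewrite /enorm dot0l sqrtr0. Qed.

Lemma enorm_eq0 x : enorm x = 0 -> x = 0.
Proof. by move=> x0; apply: dot_eq0; rewrite -enorm_sqr x0 expr0n. Qed.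

Lemma enormZ c x : enorm (c *: x) = `|c| * enorm x.
Proof.
by rewrite /enorm dotZl dotZr mulrA -expr2 sqrtrM ?sqr_ge0// sqrtr_sqr.
Qed.

Lemma enormN x : enorm (- x) = enorm x.
Proof. by rewrite -scaleN1r enormZ normrN normr1 mul1r. Qed.

Lemma enormB x y : enorm (x - y) = enorm (y - x).
Proof. by rewrite -enormN opprB. Qed.

Lemma dot_le_enorm x y : dot x y <= enorm x * enorm y.
Proof.
have [x0|x0] := eqVneq (enorm x) 0.
  by rewrite (enorm_eq0 x0) dot0l enorm0 mul0r.
have [y0|y0] := eqVneq (enorm y) 0.
  by rewrite (enorm_eq0 y0) dot0r enorm0 mulr0.
have xy : 0 < enorm x * enorm y.
  by rewrite mulr_gt0// lt0r ?x0 ?y0 enorm_ge0.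
have := dot_ge0 (enorm y *: x - enorm x *: y).
rewrite !dotE -!enorm_sqr (dotC y x) => h.
rewrite -(ler_pM2l xy); nra.
Qed.

Lemma ler_norm_dot x y : `|dot x y| <= enorm x * enorm y.
Proof.
by rewrite ler_norml dot_le_enorm lerNl -dotNl -(enormN x) dot_le_enorm.
Qed.

Lemma enormD x y : enorm (x + y) <= enorm x + enorm y.
Proof.
rewrite enorm_le ?addr_ge0 ?enorm_ge0// !dotE (dotC y x).
by have := dot_le_enorm x y; rewrite -!enorm_sqr sqrrD; lra.
Qed.

Lemma enorm_distD x y z : enorm (x - z) <= enorm (x - y) + enorm (y - z).
Proof. by have := enormD (x - y) (y - z); rewrite addrA subrK. Qed.

Lemma enorm_le_dot x c : 0 <= c -> (forall y, dot x y <= c * enorm y) -> enorm x <= c.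
Proof.
move=> c0 /(_ x); rewrite -enorm_sqr expr2.
have [->|x0] := eqVneq (enorm x) 0; first by [].
by rewrite ler_pM2r// lt0r x0 enorm_ge0.
Qed.

Lemma enorm_sum (I : Type) (r : seq I) (P : pred I) (f : I -> V) :
  enorm (\sum_(i <- r | P i) f i) <= \sum_(i <- r | P i) enorm (f i).
Proof.
elim/big_rec2 : _ => [|i u v _ h]; first by rewrite enorm0.
by apply: (le_trans (enormD _ _)); rewrite lerD2l.
Qed.

Lemma ler_coord_enorm x i : `|x ord0 i| <= enorm x.
Proof.
rewrite -(@ler_sqr R) ?nnegrE ?enorm_ge0// enorm_sqr real_normK ?num_real//.
rewrite /dot (bigD1 i)//= -expr2 lerDl.
by apply: sumr_ge0 => j _; rewrite -expr2 sqr_ge0.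
Qed.

Lemma row_sum_coord x : x = \sum_(i < d) x ord0 i *: delta_mx ord0 i.
Proof. exact: row_sum_delta. Qed.

Lemma enorm_le_sum x : enorm x <= \sum_(i < d) `|x ord0 i|.
Proof.
rewrite {1}(row_sum_coord x); apply: (le_trans (enorm_sum _ _ _)).
apply: ler_sum => i _; rewrite enormZ -[leRHS]mulr1 ler_wpM2l//.
rewrite enorm_le// /dot (bigD1 i)//= !mxE !eqxx mulr1 big1 ?addr0 ?expr1n//.
by move=> j ji; rewrite !mxE eqxx /= (negbTE ji) mulr0.
Qed.

Lemma continuous_dot (U : topologicalType) (f : U -> V) y (u : U) :
  {for u, continuous f} -> {for u, continuous (fun w => dot (f w) y)}.
Proof.
move=> fu; rewrite /dot; apply: cvg_sum_ord => i.
apply: cvgM; last exact: cvg_cst.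
exact: (cvg_comp _ _ fu (@coord_continuous _ _ _ _ _ _)).
Qed.

Lemma continuous_enorm (U : topologicalType) (f : U -> V) (u : U) :
  {for u, continuous f} -> {for u, continuous (fun w => enorm (f w))}.
Proof.
move=> fu; rewrite /enorm.
apply: (@cvg_comp _ _ _ (fun w => dot (f w) (f w)) Num.sqrt); last exact: sqrt_continuous.
rewrite /dot; apply: cvg_sum_ord => i.
by apply: cvgM; exact: (cvg_comp _ _ fu (@coord_continuous _ _ _ _ _ _)).
Qed.

(** Passes from the library topology, given by the sup norm, to Euclidean balls: each coordinate is
    bounded by the Euclidean norm. *)
Lemma near_enorm_lt (f : V -> V) (z : V) (e : R) :
  {for z, continuous f} -> 0 < e ->
  exists2 r, 0 < r & forall x, enorm (x - z) < r -> enorm (f x - f z) < e.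
Proof.
move=> fz e0.
have gz : {for z, continuous (fun x => enorm (f x - f z))}.
  have cz : {for z, continuous (cst (f z) : V -> V)} by exact: cst_continuous.
  by apply: continuous_enorm; exact: (cvgB fz cz).
have : nbhs z [set x | enorm (f x - f z) < e].
  apply: (gz [set t | t < e]); rewrite subrr enorm0.
  exact: (open_nbhs_nbhs (conj (@open_lt _ e) e0)).
move=> /nbhs_normP[r r0 h]; exists r => // x xr; apply: h => /=.
rewrite /ball_ /= (lt_le_trans _ (lexx _))//.
rewrite [`|_|]mx_normrE; apply/bigmax_ltP; split => // -[i j] _ /=.
rewrite (le_lt_trans _ xr)// enormB (ord1 i); exact: ler_coord_enorm.
Qed.

Lemma cauchy_enorm_cvg (u : nat -> V) :
  (forall e, 0 < e -> exists N, forall m n, (N <= m)%N -> (N <= n)%N ->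
     enorm (u m - u n) < e) ->
  exists x, forall e, 0 < e -> exists N, forall n, (N <= n)%N -> enorm (u n - x) < e.
Proof.
move=> cu.
have cc (i : 'I_d) : cvgn (fun n => u n ord0 i).
  apply/cauchy_cvgP; apply: cauchy_exP => e e0; have [N hN] := cu _ e0.
  exists (u N ord0 i); exists N => // n /= Nn.
  rewrite /ball /= (le_lt_trans _ (hN _ _ (leqnn N) Nn))//.
  by have := ler_coord_enorm (u N - u n) i; rewrite !mxE.
pose x : V := \row_i lim (u n ord0 i @[n --> \oo]).
exists x => e e0.
have : (fun n => \sum_(i < d) `|(u n - x) ord0 i|) @ \oo --> \sum_(i < d) (0 : R).
  apply: cvg_sum_ord => i.
  rewrite -(normr0 R) -(subrr (x ord0 i)); apply: cvg_norm.
  have E n : (u n - x) ord0 i = u n ord0 i - x ord0 i.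
    by rewrite [LHS]mxE [X in _ + X]mxE.
  under eq_fun do rewrite E.
  have cx : (fun n => u n ord0 i) @ \oo --> x ord0 i by rewrite mxE; exact: cc.
  exact: (cvgB cx (cvg_cst _)).
rewrite big1// => /cvgrPdist_lt/(_ _ e0)[N _ hN]; exists N => n Nn.
apply: (le_lt_trans (enorm_le_sum _)).
by have := hN n Nn; rewrite sub0r normrN; apply: le_lt_trans; exact: ler_norm.
Qed.

End EuclideanSpace.

(** * Multilinear forms and iterated differentials *)

Lemma MVT_from0 {R : realType} (g g' : R -> R) (s : R) :
  (forall t : R, is_derive t 1 g (g' t)) -> 0 < s ->
  exists2 t, 0 < t < s & g s - g 0 = g' t * s.
Proof.
move=> dg s0.
have dg0 t : t \in `]0, s[ -> is_derive t 1 g (g' t) by move=> _; exact: dg.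
have cg : {within `[0, s], continuous g}.
  apply: derivable_within_continuous => t _.
  exact: (@ex_derive _ _ _ _ _ _ _ (dg t)).
have [t ts gE] := MVT s0 dg0 cg.
by exists t; [move: ts; rewrite in_itv|rewrite gE subr0].
Qed.

Lemma diff_lincomb {R : realType} (U W : normedModType R) (f g : U -> W) (c : R) (z h : U) :
  differentiable f z -> differentiable g z ->
  'd (fun w => c *: f w + g w) z h = c *: 'd f z h + 'd g z h.
Proof.
move=> df dg; have cf := differentiableZ c df; have cfg := differentiableD cf dg.
have E := etrans (deriveD (diff_derivable cf) (diff_derivable dg))
  (congr1 (fun t => t + 'D_h g z) (deriveZ c (diff_derivable df))).
exact: (etrans (esym (deriveE h cfg))
  (etrans E (congr2 (fun a b => c *: a + b) (deriveE h df) (deriveE h dg)))).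
Qed.

Arguments iter_diff : simpl never.

Section Differentials.
Context {R : realType} {d : nat}.
Notation V := 'rV[R]_d.

Lemma is_derive_dot_ray (f : V -> V) (z u e : V) (s : R) :
  differentiable f (z + s *: u) ->
  is_derive s 1 (fun t => dot (f (z + t *: u)) e) (dot ('d f (z + s *: u) u) e).
Proof.
move=> df.
have fE : h^-1 *: (f (h *: u + (z + s *: u)) - f (z + s *: u)) @[h --> 0^'] -->
    'd f (z + s *: u) u.
  by rewrite -deriveE//; exact: diff_derivable.
have gE : h^-1 *: (dot (f (z + (h *: (1 : R) + s) *: u)) e - dot (f (z + s *: u)) e)
    @[h --> 0^'] --> dot ('d f (z + s *: u) u) e.
  have -> : (fun h => h^-1 *: (dot (f (z + (h *: (1 : R) + s) *: u)) e
      - dot (f (z + s *: u)) e)) =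
      (fun h => dot (h^-1 *: (f (h *: u + (z + s *: u)) - f (z + s *: u))) e).
    apply: funext => h; rewrite dotZl dotBl.
    have -> // : z + (h *: (1 : R) + s) *: u = h *: u + (z + s *: u).
    by rewrite scalerDl /GRing.scale/= mulr1 addrCA.
  have ce : {for 'd f (z + s *: u) u, continuous (fun w => dot w e)}.
    by apply: continuous_dot; exact: cvg_id.
  exact: (cvg_comp _ _ fE ce).
by apply: DeriveDef; [apply/cvg_ex; eexists; exact: gE|exact: cvg_lim gE].
Qed.

(** Pairing with a fixed vector e makes every derivative along a line scalar, so that the
    one-variable mean value theorem applies. *)
Definition directional_derivative (f : V -> V) (u : V) (g : V -> V) :=
  forall (z e : V) (s : R), is_derive s (1 : R) (fun t : R => dot (f (z + t *: u)) e)
    (dot (g (z + s *: u)) e).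

(** Mean value theorem twice: in direction u for the increment of f by s v, then in direction v for
    fu. *)
Lemma second_difference (f fu fuv : V -> V) (z u v e : V) (s : R) :
  directional_derivative f u fu -> directional_derivative fu v fuv -> 0 < s ->
  exists a b, [/\ 0 < a < s, 0 < b < s &
    dot (f (z + s *: u + s *: v) - f (z + s *: u) - f (z + s *: v) + f z) e =
    s ^+ 2 * dot (fuv (z + a *: u + b *: v)) e].
Proof.
move=> df ddf s0.
pose g t := dot (f (z + s *: v + t *: u)) e - dot (f (z + t *: u)) e.
pose g' t := dot (fu (z + s *: v + t *: u)) e - dot (fu (z + t *: u)) e.
have dg (t : R) : is_derive t (1 : R) g (g' t).
  by have h1 := df (z + s *: v) e t; have h2 := df z e t; exact: is_deriveB.
have [t ts gE] := MVT_from0 dg s0.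
have [r rs hE] := MVT_from0 (ddf (z + t *: u) e) s0.
exists t, r; split => //.
have -> : s ^+ 2 * dot (fuv (z + t *: u + r *: v)) e = g' t * s.
  move: hE; rewrite scale0r addr0 => hE.
  rewrite /g' [z + s *: v + _]addrAC hE; ring.
rewrite -gE /g !scale0r !addr0 (addrAC z) !dotE; lra.
Qed.

(** The second difference is symmetric in u and v, so the two mixed derivatives, paired with their
    difference e at z, agree at two points near z. Continuity within |e| / 4 makes this incompatible
    with |e|^2 > 0. *)
Lemma schwarz (f fu fv fuv fvu : V -> V) (u v : V) :
  directional_derivative f u fu -> directional_derivative fu v fuv ->
  directional_derivative f v fv -> directional_derivative fv u fvu ->
  continuous fuv -> continuous fvu -> fuv = fvu.
Proof.
move=> df dfu df' dfv cuv cvu; apply/funext => z.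
have [//|AB] := eqVneq (fuv z) (fvu z).
pose e := fuv z - fvu z.
have e0 : 0 < enorm e.
  rewrite lt0r enorm_ge0 andbT; apply/eqP => /enorm_eq0/eqP.
  by rewrite subr_eq0 (negbTE AB).
have e4 : 0 < enorm e / 4 by rewrite divr_gt0.
have [r1 r10 h1] := near_enorm_lt (cuv z) e4.
have [r2 r20 h2] := near_enorm_lt (cvu z) e4.
pose r := Num.min r1 r2; pose K := enorm u + enorm v + 1.
have K0 : 0 < K by rewrite ltr_wpDl// addr_ge0// enorm_ge0.
have r0 : 0 < r by rewrite lt_min r10.
pose s := r / K; have s0 : 0 < s by rewrite divr_gt0.
have near_z a b : 0 < a < s -> 0 < b < s ->
    enorm (z + a *: u + b *: v - z) < r.
  move=> /andP[a0 a1] /andP[b0 b1].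
  rewrite addrAC [z + _ - z]addrAC subrr add0r (le_lt_trans (enormD _ _))// !enormZ !gtr0_norm//.
  have sK : s * K = r by rewrite /s divfK// gt_eqF.
  have := enorm_ge0 u; have := enorm_ge0 v; rewrite -sK /K; nra.
have [a [b [a1 b1 cE]]] := second_difference z e df dfu s0.
have [a' [b' [a1' b1' cE']]] := second_difference z e df' dfv s0.
have : s ^+ 2 * dot (fuv (z + a *: u + b *: v)) e =
       s ^+ 2 * dot (fvu (z + a' *: v + b' *: u)) e.
  by rewrite -cE -cE' (addrAC z) (addrAC (f _)).
have s2 : s ^+ 2 != 0 by rewrite expf_neq0// gt_eqF.
move/(mulfI s2) => AB0.
have /h1 hA : enorm (z + a *: u + b *: v - z) < r1.
  by apply: lt_le_trans (near_z _ _ a1 b1) _; rewrite ge_min lexx.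
have /h2 hB : enorm (z + a' *: v + b' *: u - z) < r2.
  rewrite (addrAC z); apply: lt_le_trans (near_z _ _ b1' a1') _.
  by rewrite ge_min lexx orbT.
exfalso.
have := dot_le_enorm (fuv (z + a *: u + b *: v) - fuv z) (- e).
have := dot_le_enorm (fvu (z + a' *: v + b' *: u) - fvu z) e.
have : dot (fuv z) e - dot (fvu z) e = enorm e ^+ 2 by rewrite enorm_sqr -dotBl.
rewrite !dotNr !dotBl enormN AB0.
nra.
Qed.

(** Forms live on lists and only the total length n is recorded, so fixing some arguments is consing
    or concatenating, without casts between tuple types. *)
Definition multilinear n (M : seq V -> V) := forall (l1 l2 : seq V) (c : R) (x y : V),
  (size l1 + size l2).+1 = n ->
  M (l1 ++ (c *: x + y) :: l2) = c *: M (l1 ++ x :: l2) + M (l1 ++ y :: l2).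

Definition symmetric n (M : seq V -> V) := forall (l1 l2 : seq V) (x y : V),
  (size l1 + size l2).+2 = n ->
  M (l1 ++ x :: y :: l2) = M (l1 ++ y :: x :: l2).

Section Multilinear.
Implicit Types (M : seq V -> V) (x y u v h : V) (l hs : seq V) (c : R).

Lemma multilinear_cons n M x :
  multilinear n.+1 M -> multilinear n (fun l => M (x :: l)).
Proof. by move=> MM l1 l2 c u v sz; apply: (MM (x :: l1)); rewrite /= addSn sz. Qed.

Lemma symmetric_cons n M x :
  symmetric n.+1 M -> symmetric n (fun l => M (x :: l)).
Proof. by move=> MM l1 l2 u v sz; apply: (MM (x :: l1)); rewrite /= addSn sz. Qed.

Lemma multilinear_cat n M hs :
  multilinear (n + size hs) M -> multilinear n (fun l => M (l ++ hs)).
Proof.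
move=> MM l1 l2 c u v sz; rewrite -!catA !cat_cons; apply: MM.
by rewrite size_cat addnA -addSn sz.
Qed.

Lemma symmetric_cat n M hs :
  symmetric (n + size hs) M -> symmetric n (fun l => M (l ++ hs)).
Proof.
move=> MM l1 l2 u v sz; rewrite -!catA !cat_cons; apply: MM.
by rewrite size_cat addnA -sz !addSn.
Qed.

Lemma multilinear_prefix n M hs :
  multilinear (size hs + n) M -> multilinear n (fun l => M (hs ++ l)).
Proof.
by move=> MM l1 l2 c u v sz; rewrite !catA; apply: MM; rewrite size_cat -addnA -addnS sz.
Qed.

Lemma multilinear0 n M : multilinear n.+1 M ->
  forall l : seq V, size l = n -> M (0 :: l) = 0.
Proof.
move=> MM l sz; have := MM [::] l 1 0 0; rewrite /= add0n sz => /(_ erefl).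
by rewrite scaler0 addr0 scale1r => /eqP; rewrite addrC -subr_eq subrr => /eqP.
Qed.

Lemma multilinearZ n M : multilinear n.+1 M ->
  forall (c : R) (x : V) (l : seq V), size l = n -> M (c *: x :: l) = c *: M (x :: l).
Proof.
move=> MM c x l sz; have := MM [::] l c x 0; rewrite /= add0n sz => /(_ erefl).
by rewrite addr0 (multilinear0 MM sz) addr0.
Qed.

Lemma multilinearD n M : multilinear n.+1 M ->
  forall (x y : V) (l : seq V), size l = n -> M (x + y :: l) = M (x :: l) + M (y :: l).
Proof.
move=> MM x y l sz; have := MM [::] l 1 x y; rewrite /= add0n sz => /(_ erefl).
by rewrite !scale1r.
Qed.

Lemma multilinear_sum n M : multilinear n.+1 M ->
  forall m (f : 'I_m -> V) (l : seq V), size l = n ->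
  M (\sum_(i < m) f i :: l) = \sum_(i < m) M (f i :: l).
Proof.
move=> MM m f l sz; apply: (big_morph (fun x => M (x :: l))).
  by move=> x y; exact: (multilinearD MM).
exact: (multilinear0 MM).
Qed.

Lemma multilinear_nseqZ n M c x : multilinear n M ->
  M (nseq n (c *: x)) = c ^+ n *: M (nseq n x).
Proof.
elim: n M => [|n IH] M MM; first by rewrite scale1r.
rewrite /= (multilinearZ MM) ?size_nseq// (IH _ (multilinear_cons _ MM)).
by rewrite scalerA exprS.
Qed.

(** Rescales the arguments to the unit sphere one at a time; this converts the operator norm bound
    into a bound for arbitrary arguments. *)
Lemma multilinear_bound n M c : 0 <= c -> multilinear n M ->
  (forall hs : seq V, size hs = n ->
     (forall h : V, h \in hs -> enorm h <= 1) -> enorm (M hs) <= c) ->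
  forall hs : seq V, size hs = n -> enorm (M hs) <= c * \prod_(h <- hs) enorm h.
Proof.
move=> c0; elim: n M => [|n IH] M MM Mc [|h hs]//=.
  by move=> _; rewrite big_nil mulr1; exact: Mc.
move=> [sz]; rewrite big_cons.
have [->|h0] := eqVneq h 0.
  by rewrite (multilinear0 MM sz) enorm0 mul0r mulr0.
have h1 : 0 < enorm h.
  rewrite lt0r enorm_ge0 andbT; apply: contraNneq h0 => /enorm_eq0 ->; exact: eqxx.
have -> : h = enorm h *: ((enorm h)^-1 *: h).
  by rewrite scalerA divff ?gt_eqF// scale1r.
rewrite (multilinearZ MM _ _ sz) !enormZ normfV !gtr0_norm//.
rewrite mulVf ?gt_eqF// mulr1 mulrCA ler_pM2l//.
apply: (IH (fun l => M ((enorm h)^-1 *: h :: l))) => //.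
  exact: multilinear_cons.
move=> hs' sz' hs'1; apply: Mc; first by rewrite /= sz'.
move=> k; rewrite inE => /predU1P[->|/hs'1//].
by rewrite enormZ gtr0_norm ?invr_gt0// mulVf ?gt_eqF.
Qed.

Lemma symmetric_nseq_swap n M u v i l : symmetric n M -> (i + size l).+1 = n ->
  M (v :: nseq i u ++ l) = M (nseq i u ++ v :: l).
Proof.
elim: i n M => [//|i IH] [//|n] M SM /= [sz].
rewrite (SM [::]) /=; last by rewrite add0n size_cat size_nseq -sz.
by rewrite (IH n (fun l => M (u :: l)))//; exact: symmetric_cons.
Qed.

Lemma pascal_sum n (t : nat -> V) :
  \sum_(i < n.+2) 'C(n.+1, i)%:R *: t i =
  \sum_(i < n.+1) 'C(n, i)%:R *: t i + \sum_(i < n.+1) 'C(n, i)%:R *: t i.+1.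
Proof.
rewrite big_ord_recl /= bin0 [X in _ = X + _]big_ord_recl /= bin0 -addrA; congr (_ + _).
under eq_bigr do rewrite binS natrD scalerDl.
rewrite big_split /=; congr (_ + _).
rewrite big_ord_recr /= bin_small ?leqnn// scale0r addr0.
by apply: eq_bigr => i _.
Qed.

(** Expanding the first argument gives two sums that Pascal's rule merges, once symmetry has moved v
    behind the copies of u. *)
Lemma multilinear_binomial n M u v : multilinear n M -> symmetric n M ->
  M (nseq n (u + v)) =
  \sum_(i < n.+1) 'C(n, i)%:R *: M (nseq (n - i) u ++ nseq i v).
Proof.
elim: n M => [|n IH] M MM SM; first by rewrite big_ord1 /= bin0 scale1r.
rewrite /= (multilinearD MM) ?size_nseq//.
rewrite (pascal_sum n (fun i => M (nseq (n.+1 - i) u ++ nseq i v))).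
rewrite !(fun x => IH _ (multilinear_cons x MM) (symmetric_cons x SM)).
congr (_ + _); apply: eq_bigr => -[i] /= ile _; first by rewrite subSn.
rewrite subSS (@symmetric_nseq_swap n.+1)// size_nseq subnK//.
Qed.

Lemma continuous_multilinear_nseq (T : topologicalType) n M (f : T -> V) (t : T) :
  multilinear n M ->
  {for t, continuous f} -> {for t, continuous (fun w => M (nseq n (f w)))}.
Proof.
move=> MM cf; elim: n M MM => [|n IH] M MM; first exact: cvg_cst.
have -> : (fun w => M (nseq n.+1 (f w))) = (fun w => \sum_(i < d)
    f w ord0 i *: M (delta_mx ord0 i :: nseq n (f w))).
  apply: funext => w /=; rewrite {1}[f w]row_sum_coord (multilinear_sum MM) ?size_nseq//.
  by apply: eq_bigr => i _; rewrite (multilinearZ MM) ?size_nseq.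
apply: cvg_sum_ord => i; apply: cvgZ.
  exact: (cvg_comp _ _ cf (@coord_continuous _ _ _ _ _ _)).
exact: (IH _ (multilinear_cons _ MM)).
Qed.

End Multilinear.

(** * Multilinearity, symmetry and Taylor polynomials of iterated differentials *)

Section IterDiff.
Variables (q : nat) (F : V -> V).
Hypothesis CF : continuously_differentiable q F.
Implicit Types (hs l : seq V) (z h u v x y : V) (c : R).

Lemma differentiable_iter_diff hs z : (size hs < q)%N -> differentiable (iter_diff F hs) z.
Proof. by move=> sz; exact: CF.1. Qed.

Lemma directional_derivative_iter_diff u hs : (size hs < q)%N ->
  directional_derivative (iter_diff F hs) u (iter_diff F (u :: hs)).
Proof.
by move=> sz z e s; apply: is_derive_dot_ray; exact: differentiable_iter_diff.
Qed.

Lemma iter_diff_cons h hs z : iter_diff F (h :: hs) z = 'd (iter_diff F hs) z h.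
Proof. by []. Qed.

(** In the first slot this is linearity of the differential. In a later slot the identity holds at
    every point by induction, hence as an equality of functions, which can be differentiated. *)
Lemma iter_diff_multilinear n z : (n <= q)%N -> multilinear n (fun hs => iter_diff F hs z).
Proof.
move=> nq l1; elim: l1 n nq z => [|h l1 IH] n nq z l2 c x y sz.
  by rewrite /= !iter_diff_cons linearP.
have sz' : (size l1 + size l2 < q)%N by rewrite -sz in nq; exact: leq_ltn_trans nq.
have E : iter_diff F (l1 ++ (c *: x + y) :: l2) =
    (fun w => c *: iter_diff F (l1 ++ x :: l2) w + iter_diff F (l1 ++ y :: l2) w).
  apply/funext => w; apply: (IH n.-1) => //.
    by rewrite -sz in nq *; exact: ltnW.
  by rewrite -sz.
have dx w : differentiable (iter_diff F (l1 ++ w :: l2)) z.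
  by apply: differentiable_iter_diff; rewrite size_cat /= addnS -sz in nq *.
exact: (etrans (congr1 (fun G => 'd G z h) E) (diff_lincomb c h (dx x) (dx y))).
Qed.

Lemma iter_diff_symmetric n z : (n <= q)%N -> symmetric n (fun hs => iter_diff F hs z).
Proof.
move=> nq l1 l2 x y sz; suff -> : iter_diff F (l1 ++ x :: y :: l2) =
  iter_diff F (l1 ++ y :: x :: l2) by [].
elim: l1 n nq sz => [|h l1 IH] n nq sz; last first.
  by apply/funext => w; rewrite /= !iter_diff_cons (IH n.-1) ?(leq_trans (leq_pred _))// -sz.
rewrite /= add0n in sz *; rewrite -sz in nq.
have dl u : directional_derivative (iter_diff F l2) u (iter_diff F (u :: l2)).
  by apply: directional_derivative_iter_diff; exact: ltnW.
have dll u v : directional_derivative (iter_diff F (v :: l2)) u (iter_diff F (u :: v :: l2)).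
  exact: directional_derivative_iter_diff.
by apply: (schwarz (dl y) (dll x y) (dl x) (dll y x)); exact: CF.2.
Qed.

Lemma iter_diff_multilinear_cat n hs z : (n + size hs <= q)%N ->
  multilinear n (fun l => iter_diff F (l ++ hs) z).
Proof.
by move=> nq; apply: (multilinear_cat (M := iter_diff F ^~ z)); exact: iter_diff_multilinear.
Qed.

Lemma iter_diff_nseqZ n hs z c u : (n + size hs <= q)%N ->
  iter_diff F (nseq n (c *: u) ++ hs) z = c ^+ n *: iter_diff F (nseq n u ++ hs) z.
Proof. by move=> nq; exact: (multilinear_nseqZ _ _ (iter_diff_multilinear_cat z nq)). Qed.

(** The Taylor polynomial of degree m at h of the map z |-> D^i F(z)[hs], i the length of hs, at the
    increment u. Keeping hs as a parameter makes the family closed under differentiation and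
    recentering. *)
Definition taylor m (hs : seq V) (h u : V) : V :=
  \sum_(i < m.+1) (i`!%:R)^-1 *: iter_diff F (nseq i u ++ hs) h.

Lemma taylorS m hs h u : taylor m.+1 hs h u =
  taylor m hs h u + (m.+1`!%:R)^-1 *: iter_diff F (nseq m.+1 u ++ hs) h.
Proof. by rewrite /taylor big_ord_recr. Qed.

(** Recentering of a Taylor polynomial. It yields both the derivative along a line that misses the
    center and the comparison of two models with different centers. *)
Lemma taylorD m hs h u v : (m + size hs <= q)%N ->
  taylor m hs h (u + v) =
  \sum_(j < m.+1) (j`!%:R)^-1 *: taylor (m - j) (nseq j v ++ hs) h u.
Proof.
elim: m => [|m IH] sz; first by rewrite /taylor !big_ord1 /= fact0 invr1 !scale1r.
rewrite taylorS (IH (ltnW sz)) [RHS]big_ord_recr /= subnn.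
have -> : \sum_(i < m.+1) (i`!%:R)^-1 *: taylor (m.+1 - i) (nseq i v ++ hs) h u =
    \sum_(i < m.+1) (i`!%:R)^-1 *: taylor (m - i) (nseq i v ++ hs) h u +
    \sum_(i < m.+1) (i`!%:R)^-1 *: ((m.+1 - i)`!%:R^-1 *:
      iter_diff F (nseq (m.+1 - i) u ++ nseq i v ++ hs) h).
  rewrite -big_split /=; apply: eq_bigr => -[i] /= im _.
  by rewrite subSn// taylorS scalerDr.
rewrite -addrA; congr (_ + _).
rewrite (@multilinear_binomial m.+1 (fun l => iter_diff F (l ++ hs) h)); last 2 first.
  exact: iter_diff_multilinear_cat.
  by apply: (@symmetric_cat m.+1 (fun l => iter_diff F l h)); exact: iter_diff_symmetric.
rewrite scaler_sumr big_ord_recr /= /taylor big_ord1 /= fact0 invr1 scale1r.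
rewrite subnn binn !scale1r; congr (_ + _); apply: eq_bigr => -[i] /= im _.
rewrite -catA !scalerA; congr (_ *: _).
have im' : (i <= m.+1)%N by exact: ltnW.
rewrite -(bin_fact im') !natrM.
have n0 k : k`!%:R != 0 :> R by rewrite pnatr_eq0 -lt0n fact_gt0.
have b0 : 'C(m.+1, i)%:R != 0 :> R by rewrite pnatr_eq0 -lt0n bin_gt0.
by field; rewrite b0 !n0.
Qed.

Lemma taylor_multilinear n m h u : (m + n <= q)%N ->
  multilinear n (fun l => taylor m l h u).
Proof.
move=> mn l1 l2 c x y sz; rewrite /taylor scaler_sumr -big_split; apply: eq_bigr.
move=> -[i] /= im _.
have MM : multilinear n (fun l => iter_diff F (nseq i u ++ l) h).
  apply: (multilinear_prefix (M := iter_diff F ^~ h)).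
  apply: iter_diff_multilinear; rewrite size_nseq (leq_trans _ mn)//.
  by rewrite leq_add2r.
by rewrite (MM l1 l2 c x y sz) scalerDr !scalerA mulrC.
Qed.

Lemma taylor_at0 m hs h : (m + size hs <= q)%N -> taylor m hs h 0 = iter_diff F hs h.
Proof.
move=> sz; rewrite /taylor big_ord_recl /= fact0 invr1 scale1r big1 ?addr0//.
move=> -[i] /= im _; have sz' : (i.+1 + size hs <= q)%N.
  by apply: leq_trans sz; rewrite leq_add2r.
have E := iter_diff_nseqZ h 0 0 sz'; rewrite expr0n !scale0r in E.
by rewrite [iter_diff _ _ _]E scaler0.
Qed.

End IterDiff.
End Differentials.

(** * The regularized Taylor model *)

Section RealCalculus.
Context {R : realType}.
Implicit Types (g : R -> R) (s t c x y : R).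

Lemma is_derive_monomial (n : nat) (t0 c t : R) :
  is_derive t (1 : R) (fun s => (s - t0) ^+ n * c) (n%:R * (t - t0) ^+ n.-1 * c).
Proof.
have h1 : is_derive t (1 : R) (fun s => s - t0) 1.
  by have := is_deriveB (is_derive_id t (1 : R)) (is_derive_cst t0 t (1 : R)); rewrite subr0.
have := is_deriveM (is_deriveX n h1) (is_derive_cst c t (1 : R)).
rewrite exprfctE scaler0 add0r /GRing.scale/= mulr1 => h2.
have -> : n%:R * (t - t0) ^+ n.-1 * c = c * (n%:R * (t - t0) ^+ n.-1) by rewrite mulrC.
exact: h2.
Qed.

Lemma is_derive_monomial0 (n : nat) (c t : R) :
  is_derive t (1 : R) (fun s => s ^+ n * c) (n%:R * t ^+ n.-1 * c).
Proof.
have := is_derive_monomial n 0 c t; rewrite subr0.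
by under eq_fun do rewrite subr0.
Qed.

(** The function g(t) + c t^(n+1) / (n+1) is compared at 0 and s by the mean value theorem, for g
    and for - g; this takes the place of integrating the bound. *)
Lemma derive_bound (g g' : R -> R) c (n : nat) s :
  (forall t : R, is_derive t (1 : R) g (g' t)) ->
  (forall t, 0 < t -> `|g' t| <= c * t ^+ n) -> 0 <= s ->
  `|g s - g 0| <= c * s ^+ n.+1 / n.+1%:R.
Proof.
move=> dg bg; rewrite le_eqVlt => /predU1P[<-|s0].
  by rewrite subrr normr0 expr0n mulr0 mul0r.
have aux (h h' : R -> R) : (forall t : R, is_derive t (1 : R) h (h' t)) ->
    (forall t, 0 < t -> - (c * t ^+ n) <= h' t) ->
    h 0 - h s <= c * s ^+ n.+1 / n.+1%:R.
  move=> dh bh.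
  have dk t := is_deriveD (dh t) (is_derive_monomial0 n.+1 (c / n.+1%:R) t).
  have [t /andP[t0 _] E] := MVT_from0 dk s0.
  have : 0 <= (h' t + n.+1%:R * t ^+ n * (c / n.+1%:R)) * s.
    rewrite mulr_ge0 ?(ltW s0)//; have := bh t t0.
    have -> : n.+1%:R * t ^+ n * (c / n.+1%:R) = c * t ^+ n.
      have : n.+1%:R != 0 :> R by rewrite pnatr_eq0.
      by move: n.+1%:R => m m0; field.
    lra.
  rewrite -E.
  have k_val r : (h + (fun s => s ^+ n.+1 * (c / n.+1%:R))) r =
      h r + r ^+ n.+1 * (c / n.+1%:R) by [].
  rewrite !k_val.
  have -> : c * s ^+ n.+1 / n.+1%:R = s ^+ n.+1 * (c / n.+1%:R) by rewrite mulrA (mulrC c).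
  by rewrite expr0n /= mul0r addr0; move: (s ^+ n.+1 * _) => w h1; lra.
rewrite ler_norml; apply/andP; split.
  rewrite lerNl opprB; apply: (aux _ _ dg) => t t0.
  by have := bg t t0; rewrite ler_norml => /andP[].
have := aux _ _ (fun t => is_deriveN (dg t)); rewrite /= opprK addrC; apply => t t0.
by rewrite lerN2; have := bg t t0; rewrite ler_norml => /andP[].
Qed.

Lemma derive_nondecreasing_ge0 (g : R -> R) (g' : R) :
  is_derive (0 : R) (1 : R) g g' -> (forall t, 0 < t -> g 0 <= g t) -> 0 <= g'.
Proof.
move=> [dg <-] mg; rewrite ['D_1 g 0]cvg_at_rightE//.
apply: limr_ge.
  rewrite -(cvg_at_rightE (fun h : R => h^-1 *: ((g \o shift 0) _ - g 0)))//.
  apply: cvg_trans dg; apply: cvg_app => A [e e0 Ae]; exists e => // x xe x0.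
  by apply: Ae => //; exact: lt0r_neq0.
near=> h; have h0 : 0 < h by [].
rewrite /= mulr_ge0 ?invr_ge0 ?(ltW h0)// subr_ge0 addr0 [_%:A]mulr1.
exact: mg.
Unshelve. all: by end_near. Qed.

(** The induction closes with (a - b) (a^n - b^n) >= 0. *)
Lemma pow_convex (n : nat) a b t : 0 <= a -> 0 <= b -> 0 <= t <= 1 ->
  ((1 - t) * a + t * b) ^+ n <= (1 - t) * a ^+ n + t * b ^+ n.
Proof.
move=> a0 b0 /andP[t0 t1]; elim: n => [|n IH]; first by rewrite !expr0; lra.
rewrite !exprS; have m0 : 0 <= (1 - t) * a + t * b by nra.
apply: (le_trans (ler_wpM2l m0 IH)).
have : 0 <= (a - b) * (a ^+ n - b ^+ n).
  rewrite subrXX mulrA -expr2 mulr_ge0 ?sqr_ge0//.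
  by apply: sumr_ge0 => i _; rewrite mulr_ge0// exprn_ge0.
have : 0 <= t * (1 - t) by nra.
move: (a ^+ n) (b ^+ n) => A B; nra.
Qed.

Lemma ler_dist_pow (n : nat) x y m : 0 <= x <= m -> 0 <= y <= m ->
  `|x ^+ n - y ^+ n| <= n%:R * m ^+ n.-1 * `|x - y|.
Proof.
move=> /andP[x0 xm] /andP[y0 ym]; rewrite subrXX normrM mulrC ler_wpM2r//.
apply: (le_trans (ler_norm_sum _ _ _)).
have m0 := le_trans x0 xm.
have -> : n%:R * m ^+ n.-1 = \sum_(i < n) m ^+ n.-1.
  by rewrite sumr_const card_ord mulr_natl.
apply: ler_sum => -[i] /= ile _.
rewrite normrM !ger0_norm ?exprn_ge0//.
have -> : m ^+ n.-1 = m ^+ (n.-1 - i) * m ^+ i.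
  by rewrite -exprD subnK// -ltnS (leq_trans ile)// leqSpred.
by apply: ler_pM; rewrite ?exprn_ge0// lerXn2r ?nnegrE.
Qed.

End RealCalculus.

Section PowerMap.
Context {R : realType} {d : nat}.
Notation V := 'rV[R]_d.

(** The two sides differ by (|a|^n - |b|^n) (|a|^2 - |b|^2) / 2. The mean of the two powers is kept
    because it is the quantity that bounds the defect of monotonicity of the Taylor polynomial. *)
Lemma power_map_monotone n (a b : V) :
  (enorm a ^+ n + enorm b ^+ n) / 2 * enorm (a - b) ^+ 2 <=
  dot (enorm a ^+ n *: a - enorm b ^+ n *: b) (a - b).
Proof.
rewrite enorm_sqr !dotE (dotC b a) -!enorm_sqr.
have : 0 <= (enorm a ^+ n - enorm b ^+ n) * (enorm a ^+ 2 - enorm b ^+ 2).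
  rewrite !subrXX mulrACA -expr2 mulr_ge0 ?sqr_ge0// mulr_ge0//;
    by apply: sumr_ge0 => i _; rewrite mulr_ge0 ?exprn_ge0 ?enorm_ge0.
move: (enorm a ^+ n) (enorm b ^+ n) (enorm a ^+ 2) (enorm b ^+ 2) (dot a b) => A B a2 b2 ab.
lra.
Qed.

Lemma power_map_lipschitz n (a b : V) :
  enorm (enorm a ^+ n *: a - enorm b ^+ n *: b) <=
  n.+1%:R * (enorm a + enorm b) ^+ n * enorm (a - b).
Proof.
have -> : enorm a ^+ n *: a - enorm b ^+ n *: b =
    enorm a ^+ n *: (a - b) + (enorm a ^+ n - enorm b ^+ n) *: b.
  by rewrite scalerBr scalerBl addrA subrK.
apply: (le_trans (enormD _ _)); rewrite !enormZ.
have a0 := enorm_ge0 a; have b0 := enorm_ge0 b; have ab0 := enorm_ge0 (a - b).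
have S0 : 0 <= enorm a + enorm b by lra.
have h1 : enorm a ^+ n <= (enorm a + enorm b) ^+ n by rewrite lerXn2r ?nnegrE//; lra.
have h2 : `|enorm a - enorm b| <= enorm (a - b).
  rewrite ler_norml; have := enormD (a - b) b; have := enormD (b - a) a.
  by rewrite !subrK (enormB b); lra.
have h3 : `|enorm a ^+ n - enorm b ^+ n| * enorm b <=
    n%:R * (enorm a + enorm b) ^+ n * enorm (a - b).
  case: n {h1} => [|n]; first by rewrite subrr normr0 !mul0r.
  have := @ler_dist_pow R n.+1 (enorm a) (enorm b) (enorm a + enorm b).
  move=> /(_ ltac:(lra) ltac:(lra)) h.
  apply: (le_trans (ler_pM (normr_ge0 _) b0 h (_ : _ <= enorm a + enorm b))); first lra.
  rewrite exprSr -!mulrA ler_wpM2l// ler_wpM2l ?exprn_ge0//= mulrC ler_wpM2l//.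
rewrite ger0_norm ?exprn_ge0//.
have := ler_wpM2r ab0 h1; rewrite -natr1; move: h3.
move: (_ ^+ n) => A; lra.
Qed.

End PowerMap.

(** * Monotonicity, accuracy and stability of the model *)

Section TaylorModel.
Context {R : realType} {d : nat}.
Notation V := 'rV[R]_d.
Implicit Types (hs : seq V) (h u v x y z g e : V) (s t : R).
Variables (q : nat) (F : V -> V) (L : R).
Hypotheses (q_gt0 : (0 < q)%N) (F_mono : monotone_op (fun z => [set F z])).
Hypotheses (CF : continuously_differentiable q F) (L_gt0 : 0 < L).
Hypothesis LF : forall z z' : V,
  (op_norm (fun hs : q.-tuple V => (iter_diff F hs z - iter_diff F hs z')%R)
     <= (L * enorm (z - z'))%:E)%E.

Lemma iter_diff_lipschitz hs z z' : size hs = q ->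
  enorm (iter_diff F hs z - iter_diff F hs z') <=
  L * enorm (z - z') * \prod_(h <- hs) enorm h.
Proof.
apply: (multilinear_bound (M := fun l => iter_diff F l z - iter_diff F l z')).
- by rewrite mulr_ge0 ?enorm_ge0 ?ltW.
- move=> l1 l2 c x y sz.
  rewrite (iter_diff_multilinear CF z (leqnn q)) //.
  rewrite (iter_diff_multilinear CF z' (leqnn q)) //.
  by rewrite scalerBr opprD addrACA.
- move=> l sz l1; rewrite -lee_fin; apply: le_trans (LF z z').
  apply: ereal_sup_ubound; have szl : size l == q by apply/eqP.
  by exists (Tuple szl) => // i; apply: l1; exact: mem_tnth.
Qed.

Lemma is_derive_taylor m hs h u e (s : R) : (m.+1 + size hs <= q)%N ->
  is_derive s (1 : R) (fun t => dot (taylor F m.+1 hs h (t *: u)) e)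
    (dot (taylor F m (u :: hs) h (s *: u)) e).
Proof.
have nseqZS n (c : R) : (n.+1 + size hs <= q)%N ->
    iter_diff F (nseq n (c *: u) ++ u :: hs) h =
    c ^+ n *: iter_diff F (nseq n.+1 u ++ hs) h.
  have -> : nseq n.+1 u ++ hs = nseq n u ++ u :: hs by rewrite -(addn1 n) nseqD -catA.
  by move=> nq; apply: (iter_diff_nseqZ CF); rewrite /= addnS.
elim: m s => [|m IH] s sz.
  have -> : (fun t => dot (taylor F 1 hs h (t *: u)) e) =
      (fun t => dot (iter_diff F hs h) e + t ^+ 1 * dot (iter_diff F (u :: hs) h) e).
    apply/funext => t; have E := iter_diff_nseqZ CF h t u (n := 1) sz.
    rewrite /taylor big_ord_recl big_ord1 /bump /= fact0 (_ : 1`! = 1)%N//.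
    by rewrite invr1 !scale1r [iter_diff _ (_ *: _ :: _) _]E !dotE.
  have -> : dot (taylor F 0 (u :: hs) h (s *: u)) e =
      0 + 1%:R * s ^+ 0 * dot (iter_diff F (u :: hs) h) e.
    by rewrite /taylor big_ord1 /= fact0 invr1 scale1r expr0 !mul1r add0r.
  exact: is_deriveD (is_derive_cst _ s (1 : R)) (is_derive_monomial0 1 _ s).
have -> : (fun t => dot (taylor F m.+2 hs h (t *: u)) e) =
    (fun t => dot (taylor F m.+1 hs h (t *: u)) e + t ^+ m.+2 *
      (m.+2`!%:R^-1 * dot (iter_diff F (nseq m.+2 u ++ hs) h) e)).
  apply/funext => t; rewrite taylorS (iter_diff_nseqZ CF)// !dotE; congr (_ + _); ring.
have -> : dot (taylor F m.+1 (u :: hs) h (s *: u)) e =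
    dot (taylor F m (u :: hs) h (s *: u)) e + m.+2%:R * s ^+ m.+1 *
      (m.+2`!%:R^-1 * dot (iter_diff F (nseq m.+2 u ++ hs) h) e).
  rewrite taylorS nseqZS// !dotE; congr (_ + _).
  rewrite (factS m.+1) natrM invfM.
  have : m.+2%:R != 0 :> R by rewrite pnatr_eq0.
  have : m.+1`!%:R != 0 :> R by rewrite pnatr_eq0 -lt0n fact_gt0.
  by move: m.+2%:R m.+1`!%:R => a b a0 b0; field; rewrite a0.
exact: is_deriveD (IH s (ltnW sz)) (is_derive_monomial0 m.+2 _ s).
Qed.

(** Differentiating in s moves one copy of u from the polynomial into [hs] and lowers the degree. At
    degree 0 all q slots are filled and the Lipschitz hypothesis applies; each return step
    contributes one factor of the factorial. *)
Lemma taylor_remainder_ray m hs h u e s : (m + size hs)%N = q -> 0 <= s ->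
  `|dot (iter_diff F hs (h + s *: u) - taylor F m hs h (s *: u)) e| <=
  L * (enorm u ^+ m.+1 * \prod_(k <- hs) enorm k * enorm e) * s ^+ m.+1 / m.+1`!%:R.
Proof.
elim: m hs s => [|m IH] hs s sz s0.
  rewrite /taylor big_ord1 /= fact0 invr1 scale1r mulr1 !expr1.
  apply: (le_trans (ler_norm_dot _ _)); rewrite -[leRHS]mulrA.
  apply: (le_trans (ler_wpM2r (enorm_ge0 _) (iter_diff_lipschitz _ _ sz))).
  rewrite addrC addKr enormZ ger0_norm// le_eqVlt; apply/orP; left; apply/eqP; ring.
pose g t := dot (iter_diff F hs (h + t *: u) - taylor F m.+1 hs h (t *: u)) e.
pose g' t := dot (iter_diff F (u :: hs) (h + t *: u) - taylor F m (u :: hs) h (t *: u)) e.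
have szq : (size hs < q)%N by rewrite -sz addSn ltnS leq_addl.
have dg t : is_derive t (1 : R) g (g' t).
  rewrite /g /g'; under eq_fun do rewrite dotBl.
  rewrite dotBl; apply: is_deriveB.
    exact: (directional_derivative_iter_diff CF).
  by apply: is_derive_taylor; rewrite sz.
have -> : dot (iter_diff F hs (h + s *: u) - taylor F m.+1 hs h (s *: u)) e = g s - g 0.
  by rewrite /g scale0r addr0 (taylor_at0 CF) ?sz// subrr dot0l subr0.
have bg t : 0 < t -> `|g' t| <= L * (enorm u ^+ m.+2 * \prod_(k <- hs) enorm k * enorm e)
    / m.+1`!%:R * t ^+ m.+1.
  move=> t0; have := IH (u :: hs) t; rewrite /= addnS -sz big_cons => /(_ erefl (ltW t0)).
  move/le_trans; apply; rewrite le_eqVlt; apply/orP; left; apply/eqP.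
  by rewrite (exprSr _ m.+1); ring.
apply: (le_trans (derive_bound dg bg s0)).
rewrite (factS m.+1) natrM invfM le_eqVlt; apply/orP; left; apply/eqP.
by move: (m.+1`!%:R^-1) (m.+2%:R^-1) => a b; ring.
Qed.

Lemma taylor_remainder m hs h u : (m + size hs)%N = q ->
  enorm (iter_diff F hs (h + u) - taylor F m hs h u) <=
  L * enorm u ^+ m.+1 * \prod_(k <- hs) enorm k / m.+1`!%:R.
Proof.
move=> sz; apply: enorm_le_dot => [|e].
  have : 0 <= \prod_(k <- hs) enorm k by apply: prodr_ge0 => i _; exact: enorm_ge0.
  have : 0 <= (m.+1`!%:R)^-1 :> R by rewrite invr_ge0 ler0n.
  by move=> *; rewrite !mulr_ge0 ?exprn_ge0 ?enorm_ge0// ltW.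
have := taylor_remainder_ray h u e sz ler01; rewrite !scale1r expr1n mulr1.
move=> /(le_trans (ler_norm _))/le_trans; apply.
by rewrite le_eqVlt; apply/orP; left; apply/eqP; ring.
Qed.

Lemma iter_diff_ge0 z g : 0 <= dot (iter_diff F [:: g] z) g.
Proof.
have dF := directional_derivative_iter_diff CF g (hs := [::]) q_gt0 z g 0.
rewrite scale0r addr0 in dF.
apply: (derive_nondecreasing_ge0 dF) => t t0.
rewrite scale0r addr0 -subr_ge0 -dotBl.
have := F_mono (x := z + t *: g) (y := z) erefl erefl.
by rewrite addrAC subrr add0r dotZr pmulr_rge0.
Qed.

(** Recentered at u + t g, the polynomial is a polynomial in s - t, and the derivative is its linear
    coefficient. *)
Lemma is_derive_taylor_shift h u g e (t : R) :
  is_derive t (1 : R) (fun s => dot (taylor F q [::] h (u + s *: g)) e)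
    (dot (taylor F q.-1 [:: g] h (u + t *: g)) e).
Proof.
pose b j := (j`!%:R)^-1 * dot (taylor F (q - j) (nseq j g) h (u + t *: g)) e.
have -> : (fun s => dot (taylor F q [::] h (u + s *: g)) e) =
    (fun s => \sum_(j < q.+1) (s - t) ^+ j * b j).
  apply/funext => s.
  have -> : u + s *: g = u + t *: g + (s - t) *: g.
    by rewrite -addrA -scalerDl subrKC.
  rewrite (taylorD CF) ?addn0// dot_suml; apply: eq_bigr => -[j] /= jq _.
  have jq' : (q - j + j <= q)%N by rewrite subnK.
  rewrite cats0 (multilinear_nseqZ _ _ (taylor_multilinear CF h _ jq')).
  by rewrite !dotZl /b; ring.
have -> : dot (taylor F q.-1 [:: g] h (u + t *: g)) e = b 1.
  by rewrite /b (_ : 1`! = 1)%N// invr1 mul1r subn1.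
have bigD n : is_derive t (1 : R) (fun s => \sum_(j < n.+2) (s - t) ^+ j * b j) (b 1).
  elim: n => [|n IH].
    have -> : (fun s => \sum_(j < 2) (s - t) ^+ j * b j) =
        (fun s => (s - t) ^+ 0 * b 0 + (s - t) ^+ 1 * b 1).
      by apply/funext => s; rewrite big_ord_recl big_ord1.
    have : is_derive t (1 : R) (fun s => (s - t) ^+ 0 * b 0 + (s - t) ^+ 1 * b 1)
        (0%:R * (t - t) ^+ 0.-1 * b 0 + 1%:R * (t - t) ^+ 1.-1 * b 1).
      exact: is_deriveD (is_derive_monomial 0 t _ t) (is_derive_monomial 1 t _ t).
    have -> : 0%:R * (t - t) ^+ 0.-1 * b 0 + 1%:R * (t - t) ^+ 1.-1 * b 1 = b 1.
      by rewrite expr0 !mul0r add0r !mul1r.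
    by [].
  under eq_fun do rewrite big_ord_recr /=.
  have -> : b 1 = b 1 + n.+2%:R * (t - t) ^+ n.+2.-1 * b n.+2.
    by rewrite subrr expr0n /= mulr0 mul0r addr0.
  exact: is_deriveD IH (is_derive_monomial n.+2 t _ t).
by rewrite -(prednK q_gt0); exact: bigD.
Qed.

(* The defect of the derivative is an integral of |u + t g|^q over [0, 1], which
   convexity bounds by the trapezoidal rule. *)
Lemma taylor_almost_monotone h u g :
  - (L / q`!%:R * enorm g ^+ 2 * ((enorm u ^+ q + enorm (u + g) ^+ q) / 2)) <=
  dot (taylor F q [::] h (u + g) - taylor F q [::] h u) g.
Proof.
set a := enorm u; set b := enorm (u + g); set K := L / q`!%:R * enorm g ^+ 2.
have K0 : 0 <= K.
  by rewrite mulr_ge0 ?sqr_ge0// divr_ge0 ?ler0n// ltW.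
have a0 : 0 <= a := enorm_ge0 u; have b0 : 0 <= b := enorm_ge0 (u + g).
(* The added quadratic has derivative K ((1 - t) a^q + t b^q), the chord above K |u + t g|^q, and
   its value at 1 is K times the trapezoidal mean. *)
have dk t := is_deriveD (is_derive_taylor_shift h u g g t)
  (is_deriveD (is_derive_monomial0 1 (K * a ^+ q) t)
     (is_derive_monomial0 2 (K * (b ^+ q - a ^+ q) / 2) t)).
have [t /andP[t0 t1] E] := MVT_from0 dk ltr01.
move: E; rewrite mulr1; set k := (X in X 1 - X 0 = _) => E.
have kE s : k s = dot (taylor F q [::] h (u + s *: g)) g +
  (s ^+ 1 * (K * a ^+ q) + s ^+ 2 * (K * (b ^+ q - a ^+ q) / 2)) by [].
have t01 : 0 <= t <= 1 by rewrite !ltW.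
have wq : enorm (u + t *: g) ^+ q <= (1 - t) * a ^+ q + t * b ^+ q.
  apply: le_trans (pow_convex q a0 b0 t01); rewrite lerXn2r ?nnegrE ?enorm_ge0//.
    by rewrite addr_ge0 ?mulr_ge0//; lra.
  have -> : u + t *: g = (1 - t) *: u + t *: (u + g).
    by rewrite scalerDr addrA -scalerDl subrK scale1r.
  by apply: (le_trans (enormD _ _)); rewrite !enormZ !ger0_norm//; lra.
have rem : - (K * enorm (u + t *: g) ^+ q) <= dot (taylor F q.-1 [:: g] h (u + t *: g)) g.
  have := taylor_remainder (m := q.-1) (hs := [:: g]) h (u + t *: g).
  rewrite addn1 prednK// big_seq1 => /(_ erefl) h1.
  have := iter_diff_ge0 (h + (u + t *: g)) g.
  have := dot_le_enorm (iter_diff F [:: g] (h + (u + t *: g)) -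
    taylor F q.-1 [:: g] h (u + t *: g)) g.
  move=> /le_trans/(_ (ler_wpM2r (enorm_ge0 g) h1)); rewrite dotBl /K => h2 h3.
  have -> : L / q`!%:R * enorm g ^+ 2 * enorm (u + t *: g) ^+ q =
    L * enorm (u + t *: g) ^+ q * enorm g / q`!%:R * enorm g by ring.
  lra.
have : 0 <= k 1 - k 0.
  rewrite E expr0 expr1.
  have := ler_wpM2l K0 wq; move: rem; rewrite -/a -/b.
  move: (a ^+ q) (b ^+ q) (enorm (u + t *: g) ^+ q) => A B W; lra.
rewrite !kE scale1r scale0r addr0 dotBl !expr1n !expr0n /=.
move: (a ^+ q) (b ^+ q) => A B; lra.
Qed.

Definition model h x := taylor_model q.+1 F L x h.

Lemma modelE h x : model h x = taylor F q [::] h (x - h) +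
  (L / q`!%:R) *: (enorm (x - h) ^+ q *: (x - h)).
Proof.
rewrite /model /taylor_model /= scalerA; congr (_ + _).
rewrite /taylor big_ord_recl /= fact0 invr1 scale1r; congr (_ + _).
rewrite big_add1 big_mkord; apply: eq_bigr => i _.
by rewrite cats0.
Qed.

(** With lambda = L the regularizer has coefficient L / q!, and its trapezoidal lower bound cancels
    the defect of the Taylor polynomial exactly. *)
Lemma model_monotone h x y : 0 <= dot (model h x - model h y) (x - y).
Proof.
have := taylor_almost_monotone h (y - h) (x - y).
have -> : y - h + (x - y) = x - h by rewrite addrC addrA subrK.
have := power_map_monotone q (x - h) (y - h).
have -> : x - h - (y - h) = x - y by rewrite opprB addrA subrK.
rewrite !modelE.
have K0 : 0 < L / q`!%:R by rewrite divr_gt0// ltr0n fact_gt0.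
move: (L / _) K0 => K K0 h1 h2.
rewrite opprD addrACA dotDl -scalerBr dotZl.
have := ler_wpM2l (ltW K0) h1; move: h2.
move: (enorm (x - h) ^+ q) (enorm (y - h) ^+ q) (dot _ _) (dot _ _) => A B C D; lra.
Qed.

(** The Taylor remainder contributes L / p! and the regularizer L / q! = p L / p!, with p = q + 1;
    the sum is M_p / p!. *)
Lemma model_error h x :
  enorm (model h x - F x) <= (L + q.+1%:R * L) / q.+1`!%:R * enorm (x - h) ^+ q.+1.
Proof.
rewrite modelE addrAC; apply: (le_trans (enormD _ _)).
have := taylor_remainder (m := q) (hs := [::]) h (x - h) (addn0 q).
rewrite big_nil mulr1 [h + _]addrC subrK enormB => h1.
have K0 : 0 <= L / q`!%:R by rewrite divr_ge0 ?ler0n// ltW.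
rewrite [X in _ + X]enormZ enormZ !ger0_norm ?exprn_ge0 ?enorm_ge0//.
have -> : (L + q.+1%:R * L) / q.+1`!%:R * enorm (x - h) ^+ q.+1 =
  L * enorm (x - h) ^+ q.+1 / q.+1`!%:R + L / q`!%:R * (enorm (x - h) ^+ q * enorm (x - h)).
  rewrite -exprSr factS natrM invfM.
  have : q.+1%:R != 0 :> R by rewrite pnatr_eq0.
  have : q`!%:R != 0 :> R by rewrite pnatr_eq0 -lt0n fact_gt0.
  by move: q.+1%:R q`!%:R => a b a0 b0; field; rewrite a0 b0.
by rewrite lerD2r.
Qed.

(* Both Taylor polynomials are expanded at h'; their coefficients then differ by
   the Taylor remainders of the iterated differentials of F. *)
Lemma model_center_lipschitz h h' x :
  enorm (model h' x - model h x) <=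
  2 * q.+1%:R * L * (enorm (x - h) + enorm (x - h')) ^+ q * enorm (h' - h).
Proof.
set S := enorm (x - h) + enorm (x - h').
have S0 : 0 <= S by rewrite addr_ge0// enorm_ge0.
have hS : enorm (h' - h) <= S.
  by rewrite (le_trans (enorm_distD h' x h))// enormB addrC.
have xS : enorm (x - h') <= S by rewrite lerDr enorm_ge0.
have L0 := ltW L_gt0.
have fact_inv n : 0 <= (n`!%:R^-1 : R) <= 1.
  by rewrite invr_ge0 ler0n/= invf_le1 ?ltr0n ?fact_gt0// ler1n fact_gt0.
have h1 : enorm (taylor F q [::] h' (x - h') - taylor F q [::] h (x - h)) <=
    q.+1%:R * L * S ^+ q * enorm (h' - h).
  have -> : x - h = h' - h + (x - h') by rewrite [RHS]addrC addrA subrK.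
  rewrite [taylor F q [::] h _](taylorD CF) ?addn0// [taylor F q [::] h' _]/taylor -sumrB.
  (* Each of the q + 1 coefficients contributes at most L S^q |h' - h|: the remainder supplies the
     power q - j of |h' - h| plus one, the arguments supply the power j of |x - h'|. *)
  apply: (le_trans (enorm_sum _ _ _)).
  have -> : q.+1%:R * L * S ^+ q * enorm (h' - h) =
      \sum_(j < q.+1) L * S ^+ q * enorm (h' - h).
    by rewrite sumr_const card_ord -[RHS]mulr_natl; ring.
  apply: ler_sum => -[j] /= jq _.
  rewrite -scalerBr enormZ; have /andP[f0 f1] := fact_inv j.
  rewrite ger0_norm//.
  have := taylor_remainder (m := q - j) (hs := nseq j (x - h') ++ [::]) h (h' - h).
  rewrite cats0 size_nseq subnK// => /(_ erefl).
  rewrite [h + _]addrC subrK big_nseq iter_mulr_1 => h1.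
  have r0 : 0 <= enorm (iter_diff F (nseq j (x - h')) h' -
      taylor F (q - j) (nseq j (x - h')) h (h' - h)) by exact: enorm_ge0.
  apply: (le_trans (ler_piMl r0 f1)); apply: (le_trans h1).
  have /andP[g0 g1] := fact_inv (q - j).+1.
  have -> : S ^+ q = S ^+ (q - j) * S ^+ j by rewrite -exprD subnK.
  have a1 : enorm (h' - h) ^+ (q - j) <= S ^+ (q - j).
    by rewrite lerXn2r ?nnegrE ?enorm_ge0.
  have a2 : enorm (x - h') ^+ j <= S ^+ j by rewrite lerXn2r ?nnegrE ?enorm_ge0.
  have a3 := ler_pM (exprn_ge0 _ (enorm_ge0 _)) (exprn_ge0 _ (enorm_ge0 _)) a1 a2.
  have a4 : enorm (h' - h) ^+ (q - j) * enorm (x - h') ^+ j / (q - j).+1`!%:R <=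
      S ^+ (q - j) * S ^+ j.
    by apply: le_trans a3; rewrite ler_piMr// mulr_ge0// exprn_ge0// enorm_ge0.
  have := ler_wpM2l (mulr_ge0 L0 (enorm_ge0 (h' - h))) a4.
  by rewrite exprS; congr (_ <= _); ring.
have h2 : enorm ((L / q`!%:R) *: (enorm (x - h') ^+ q *: (x - h') -
    enorm (x - h) ^+ q *: (x - h))) <= q.+1%:R * L * S ^+ q * enorm (h' - h).
  have /andP[f0 f1] := fact_inv q.
  rewrite enormZ ger0_norm ?mulr_ge0//.
  have := power_map_lipschitz q (x - h') (x - h).
  have -> : x - h' - (x - h) = - (h' - h) by rewrite opprB [RHS]opprB addrC addrA subrK.
  rewrite enormN [enorm (x - h') + _]addrC -/S => h2.
  have LL : L / q`!%:R <= L by rewrite ler_piMr.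
  apply: (le_trans (ler_pM (mulr_ge0 L0 f0) (enorm_ge0 _) LL h2)).
  by rewrite le_eqVlt; apply/orP; left; apply/eqP; ring.
rewrite !modelE opprD addrACA -scalerBr.
apply: (le_trans (enormD _ _)); apply: (le_trans (lerD h1 h2)).
by rewrite le_eqVlt; apply/orP; left; apply/eqP; ring.
Qed.

Lemma continuous_model (U : topologicalType) (f : U -> V) (p : U) h :
  {for p, continuous f} -> {for p, continuous (fun w => model h (f w))}.
Proof.
move=> cf.
have cid : {for p, continuous (fun w => f w - h)}.
  have ch : {for p, continuous (cst h : U -> V)} by exact: cst_continuous.
  exact: (cvgB cf ch).
have -> : (fun w => model h (f w)) = (fun w => taylor F q [::] h (f w - h) +
  (L / q`!%:R) *: (enorm (f w - h) ^+ q *: (f w - h))).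
  by apply/funext => w; exact: modelE.
apply: cvgD.
  rewrite /taylor; apply: cvg_sum_ord => -[i] /= iq.
  apply: cvgZ; first exact: cvg_cst.
  have iq' : (i + size (Nil V) <= q)%N by rewrite addn0.
  exact: (continuous_multilinear_nseq (iter_diff_multilinear_cat CF h iq') cid).
apply: cvgZ; first exact: cvg_cst.
apply: cvgZ => //.
have ce := continuous_enorm cid.
exact: (continuous_comp ce (@exprn_continuous R q _)).
Qed.

End TaylorModel.

(** * Minty's theorem *)

Section Minty.
Context {R : realType} {d : nat}.
Notation V := 'rV[R]_d.
Implicit Types (H G : V -> set V) (T : V -> V) (x y z u v w : V) (c e t : R).

Lemma maximal_monotone_mem H x v : maximal_monotone H ->
  (forall y w, H y w -> 0 <= dot (w - v) (y - x)) -> H x v.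
Proof.
move=> [mH maxH] h; pose G y : set V := [set w | H y w \/ y = x /\ w = v].
apply: (maxH G) => /=; last by right.
  move=> y1 y2 w1 w2 [h1|[-> ->]] [h2|[-> ->]].
  + exact: mH.
  + exact: h.
  + by rewrite -opprB dotNl -dotNr opprB; exact: h.
  + by rewrite subrr dot0l.
by move=> y w Hw; left.
Qed.

Lemma ge0_limit (X C : R) : (forall e, 0 < e <= 1 -> 0 <= X + e * C) -> 0 <= X.
Proof.
move=> h; rewrite leNgt; apply/negP => X0.
have C0 : 0 < C by have := h 1; rewrite ltr01 lexx mul1r => /(_ isT); lra.
pose e := Num.min 1 (- X / (2 * C)).
have e1 : e <= 1 by rewrite ge_min lexx.
have eC : e <= - X / (2 * C) by rewrite ge_min lexx orbT.
have e0 : 0 < e by rewrite lt_min ltr01/= divr_gt0//; lra.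
have := h e; rewrite e0 e1 => /(_ isT).
have : e * C <= - X / 2.
  have -> : - X / 2 = - X / (2 * C) * C by field; rewrite gt_eqF.
  by rewrite ler_pM2r.
lra.
Qed.

(* c bounds twice the Fitzpatrick function of H at (x, v) plus |x|^2 + |v|^2. *)
Definition fitzpatrick_level H c x v := forall y w, H y w ->
  enorm (x + w) ^+ 2 + enorm (v + y) ^+ 2 - enorm (y + w) ^+ 2 <= c.

(** On the graph the Fitzpatrick function is the pairing <x, v>, so the level is |x|^2 + |v|^2 + 2
    <x, v>. *)
Lemma fitzpatrick_level_graph H x v : monotone_op H -> H x v ->
  fitzpatrick_level H (enorm (x + v) ^+ 2) x v.
Proof.
move=> mH xv y w yw; have := mH _ _ _ _ xv yw.
rewrite !enorm_sqr !dotE (dotC v x) (dotC w x) (dotC y v) (dotC w y); lra.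
Qed.

(** The quadratic gain is kept: at t = 1/2 it makes minimizing sequences Cauchy, and for t near 0 it
    gives the first-order optimality inequality. *)
Lemma fitzpatrick_level_convex H c c' x v x' v' t : 0 <= t <= 1 ->
  fitzpatrick_level H c x v -> fitzpatrick_level H c' x' v' ->
  fitzpatrick_level H
    ((1 - t) * c + t * c' - t * (1 - t) * (enorm (x - x') ^+ 2 + enorm (v - v') ^+ 2))
    ((1 - t) *: x + t *: x') ((1 - t) *: v + t *: v').
Proof.
move=> /andP[t0 t1] l l' y w yw.
have := ler_wpM2l t0 (l' y w yw).
have t1' : 0 <= 1 - t by lra.
have := ler_wpM2l t1' (l y w yw).
have -> : (1 - t) *: x + t *: x' + w = (1 - t) *: (x + w) + t *: (x' + w).
  by rewrite !scalerDr addrACA -scalerDl subrK scale1r.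
have -> : (1 - t) *: v + t *: v' + y = (1 - t) *: (v + y) + t *: (v' + y).
  by rewrite !scalerDr addrACA -scalerDl subrK scale1r.
have -> : x - x' = x + w - (x' + w) by rewrite opprD addrACA subrr addr0.
have -> : v - v' = v + y - (v' + y) by rewrite opprD addrACA subrr addr0.
move: (x + w) (x' + w) (v + y) (v' + y) => a a' b b'.
rewrite !enorm_sqr !dotE (dotC a' a) (dotC b' b).
move: (dot y y) (dot y w) (dot w y) (dot w w) => *; lra.
Qed.

Lemma cvg_enormD (f : nat -> V) x w :
  (forall e, 0 < e -> exists N, forall n, (N <= n)%N -> enorm (f n - x) < e) ->
  (fun n => enorm (f n + w)) @ \oo --> enorm (x + w).
Proof.
move=> cf; apply/cvgrPdist_lt => e e0; have [N hN] := cf e e0.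
exists N => // n /= Nn; apply: le_lt_trans (hN n Nn).
rewrite ler_norml.
have := enormD (x - f n) (f n + w); have := enormD (f n - x) (x + w).
by rewrite !addrA !subrK (enormB x); lra.
Qed.

Lemma fitzpatrick_minimizer H : monotone_op H -> (exists x v, H x v) ->
  exists mu x v, fitzpatrick_level H mu x v /\
    forall c y w, fitzpatrick_level H c y w -> mu <= c.
Proof.
move=> mH [x0 [v0 H0]].
pose S : set R := [set c | exists x v, fitzpatrick_level H c x v].
have hS : has_inf S.
  split.
    by exists (enorm (x0 + v0) ^+ 2), x0, v0; exact: fitzpatrick_level_graph.
  exists (- enorm (x0 + v0) ^+ 2) => c [x [v /(_ _ _ H0)]]; rewrite /=.
  by have := sqr_ge0 (enorm (x + v0)); have := sqr_ge0 (enorm (v + x0)); lra.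
pose mu := inf S.
have mu_le c x v : fitzpatrick_level H c x v -> mu <= c.
  by move=> l; apply: (ge_inf hS.2); exists x, v.
have ex (n : nat) : exists p : V * V, fitzpatrick_level H (mu + n.+1%:R^-1) p.1 p.2.
  have n0 : 0 < n.+1%:R^-1 :> R by rewrite invr_gt0 ltr0n.
  have [c [x [v l]] cl] := inf_adherent n0 hS.
  by exists (x, v) => y w yw; apply: le_trans (l y w yw) _; exact: ltW.
have [p hp] := choice ex.
have close m n : enorm ((p m).1 - (p n).1) ^+ 2 + enorm ((p m).2 - (p n).2) ^+ 2 <=
    2 * (m.+1%:R^-1 + n.+1%:R^-1).
  have t : 0 <= (2^-1 : R) <= 1 by apply/andP; split; lra.
  have := mu_le _ _ _ (fitzpatrick_level_convex t (hp m) (hp n)).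
  by move: (m.+1%:R^-1) (n.+1%:R^-1) (_ + enorm _ ^+ 2) => a b D; lra.
have small e : 0 < e -> exists N : nat, forall n, (N <= n)%N -> n.+1%:R^-1 < e.
  move=> e0; have [N _ hN] := near_infty_natSinv_lt (PosNum e0).
  by exists N => n Nn; exact: hN.
have cauchy_sq (f : nat -> V) :
    (forall m n, enorm (f m - f n) ^+ 2 <= 2 * (m.+1%:R^-1 + n.+1%:R^-1)) ->
    exists x, forall e, 0 < e -> exists N, forall n, (N <= n)%N -> enorm (f n - x) < e.
  move=> hf; apply: cauchy_enorm_cvg => e e0.
  have e4 : 0 < e ^+ 2 / 4 by rewrite divr_gt0// exprn_gt0.
  have [N hN] := small _ e4; exists N => m n Nm Nn.
  rewrite -(@ltr_pXn2r R 2)// ?nnegrE ?enorm_ge0 ?ltW//.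
  move: (hf m n) (hN m Nm) (hN n Nn).
  by move: (m.+1%:R^-1) (n.+1%:R^-1) => a b; lra.
have [x hx] : exists x, forall e, 0 < e -> exists N, forall n, (N <= n)%N ->
    enorm ((p n).1 - x) < e.
  by apply: (cauchy_sq (fun n => (p n).1)) => m n;
    apply: le_trans (close m n); rewrite lerDl sqr_ge0.
have [v hv] : exists x, forall e, 0 < e -> exists N, forall n, (N <= n)%N ->
    enorm ((p n).2 - x) < e.
  by apply: (cauchy_sq (fun n => (p n).2)) => m n;
    apply: le_trans (close m n); rewrite lerDr sqr_ge0.
exists mu, x, v; split; last by move=> c y w; exact: mu_le.
move=> y w yw; rewrite lerBlDr.
have c1 := cvg_enormD (w := w) hx; have c2 := cvg_enormD (w := y) hv.
have c12 : (fun n => enorm ((p n).1 + w) ^+ 2 + enorm ((p n).2 + y) ^+ 2) @ \oo -->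
    enorm (x + w) ^+ 2 + enorm (v + y) ^+ 2.
  by rewrite !expr2; under eq_fun do rewrite !expr2; apply: cvgD; exact: cvgM.
have cmu : (fun n => mu + n.+1%:R^-1 + enorm (y + w) ^+ 2) @ \oo --> mu + 0 + enorm (y + w) ^+ 2.
  apply: cvgD; last exact: cvg_cst.
  apply: cvgD; first exact: cvg_cst.
  exact: cvg_harmonic.
rewrite addr0 in cmu; rewrite -(cvg_lim _ c12)// -(cvg_lim _ cmu)//.
apply: ler_lim; [exact: cvgP c12|exact: cvgP cmu|].
by near=> n; rewrite -lerBlDr; exact: hp.
Unshelve. all: by end_near. Qed.

(* Simons and Zalinescu: a minimizer (x, v) of the Fitzpatrick function plus
   (|x|^2 + |v|^2) / 2 satisfies v = - x and lies in the graph. *)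
Lemma minty_zero H : maximal_monotone H -> (exists x v, H x v) -> exists x, H x (- x).
Proof.
move=> maxH ne; have mH := maxH.1.
have [mu [x [v [l mu_le]]]] := fitzpatrick_minimizer mH ne.
(* The Fitzpatrick function of a maximal monotone operator dominates the pairing: a smaller value
   would make (x, v) monotonically related to the graph, hence a point of it. *)
have mu_ge : enorm (x + v) ^+ 2 <= mu.
  have [xv|nxv] := pselect (H x v); first by have := l _ _ xv; rewrite [v + x]addrC; lra.
  have [//|mu_lt] := lerP (enorm (x + v) ^+ 2) mu.
  exfalso; apply: nxv; apply: maximal_monotone_mem => // y w yw.
  have := l _ _ yw; move: mu_lt.
  rewrite !enorm_sqr !dotE (dotC v x) (dotC w x) (dotC y v) (dotC w y); lra.
(* Optimality along the segment from (x, v) towards (y, w), divided by e, as e tends to 0. *)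
have key y w : H y w -> enorm (x - y) ^+ 2 + enorm (v - w) ^+ 2 <=
    enorm (y + w) ^+ 2 - mu.
  move=> yw; have ly := fitzpatrick_level_graph mH yw.
  set D := enorm (x - y) ^+ 2 + _; rewrite -subr_ge0.
  apply: (@ge0_limit _ D) => e /andP[e0 e1].
  have e01 : 0 <= e <= 1 by rewrite ltW.
  have := mu_le _ _ _ (fitzpatrick_level_convex e01 l ly); rewrite -/D => h.
  rewrite -(pmulr_rge0 _ e0); lra.
have graph : H (- v) (- x).
  apply: maximal_monotone_mem => // y w /key.
  have := sqr_ge0 (enorm (x + v)); move: mu_ge; rewrite !enorm_sqr !opprK !dotE.
  rewrite (dotC v x) (dotC w y) (dotC w v) (dotC y x); lra.
have xv0 : x + v = 0.
  apply: dot_eq0; have := key _ _ graph; have := dot_ge0 (x + v).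
  move: mu_ge; rewrite !enorm_sqr !opprK !dotE (dotC v x); lra.
by exists x; move: graph; rewrite -(addrK v x) xv0 sub0r opprK.
Qed.

(** A zero of the shifted and scaled operator c H - y plus the identity; the work is to transfer
    maximality to c H - y. *)
Lemma minty H c y : maximal_monotone H -> (exists x v, H x v) -> 0 < c ->
  exists x v, H x v /\ c *: v + x = y.
Proof.
move=> [mH maxH] [x0 [v0 H0]] c0; have cn0 : c != 0 by rewrite gt_eqF.
pose K x : set V := [set w | H x (c^-1 *: (w + y))].
have maxK : maximal_monotone K.
  split.
    move=> x1 x2 w1 w2 h1 h2; have := mH _ _ _ _ h1 h2.
    by rewrite -scalerBr opprD addrACA subrr addr0 dotZl pmulr_rge0// invr_gt0.
  move=> G mG KG x w Gw.
  pose G' x : set V := [set v | G x (c *: v - y)].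
  apply: (maxH G') => [x1 x2 w1 w2 h1 h2|x1 w1 h1|].
  - have := mG _ _ _ _ h1 h2.
    by rewrite opprB addrA subrK -scalerBr dotZl pmulr_rge0.
  - by apply: KG; rewrite /K /= subrK scalerA mulVf// scale1r.
  - by rewrite /G' /= scalerA divff// scale1r addrK.
have [|x hx] := minty_zero maxK.
  by exists x0, (c *: v0 - y); rewrite /K /= subrK scalerA mulVf// scale1r.
exists x, (c^-1 *: (- x + y)); split => //.
by rewrite scalerA divff// scale1r addrC addNKr.
Qed.

Lemma bounded_on_ball T z r : (forall x, {for x, continuous T}) ->
  exists M : R, forall x, enorm (x - z) <= r -> enorm (T x) <= M.
Proof.
move=> cT; pose A : set V := [set x | enorm (x - z) <= r].
have [r0|r0] := ltP r 0.
  by exists 0 => x; have := enorm_ge0 (x - z); lra.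
have cf (x : V) : {for x, continuous (fun w => enorm (w - z))}.
  have cz : {for x, continuous (cst z : V -> V)} by exact: cst_continuous.
  by apply: continuous_enorm; exact: (cvgB (@cvg_id _ (nbhs x)) cz).
have clA : closed A.
  apply: (@preimage_closed _ _ (fun w => enorm (w - z)) [set t | t <= r]) => //.
  by move=> w _; exact: cf.
have bA : bounded_set A.
  exists (r + enorm z); split; first exact: num_real.
  move=> M rM x Ax; apply: le_trans (ltW rM).
  rewrite [`|_|]mx_normrE; apply/bigmax_leP; split => [|[i j] _ /=].
    by rewrite addr_ge0// enorm_ge0.
  rewrite (ord1 i); apply: (le_trans (ler_coord_enorm _ _)).
  by rewrite -[x](subrK z) (le_trans (enormD _ _))// lerD2r.
have cptA := bounded_closed_compact bA clA.
have A0 : A !=set0 by exists z; rewrite /A /= subrr enorm0.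
have [|c _ hc] := @EVT_max_rV R d (fun x => enorm (T x)) A A0 cptA.
  apply: continuous_subspaceT => x; exact: continuous_enorm.
by exists (enorm (T c)) => x Ax; apply: hc; rewrite inE.
Qed.

(* If u is monotonically related to H + T at x, then the points of the graph of H
   given by the resolvents of t H at x + t (u - T x) tend to (x, u - T x). *)
Lemma maximal_monotone_add H T : maximal_monotone H -> (exists x v, H x v) ->
  (forall x, {for x, continuous T}) -> (forall x y, 0 <= dot (T x - T y) (x - y)) ->
  maximal_monotone (fun x => [set w | H x (w - T x)]).
Proof.
move=> maxH ne cT mT; have mH := maxH.1; split.
  move=> x y u v /= h1 h2; have := mH _ _ _ _ h1 h2; have := mT x y.
  by rewrite !dotBl; lra.
move=> G mG SG x u Gu /=; set q := u - T x.
have rel y v : H y v -> 0 <= dot (v - q) (y - x) + dot (T y - T x) (y - x).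
  move=> yv; have Gy : G y (v + T y) by apply: SG; rewrite /= addrK.
  have := mG _ _ _ _ Gy Gu; rewrite /q !dotBl !dotDl; lra.
clearbody q.
have [y0 [v0 H0]] := ne.
pose r0 := enorm (x - y0) + enorm (q - v0).
have [M hM] := bounded_on_ball y0 r0 cT.
pose K := `|M| + enorm (T x) + 1.
have K0 : 0 < K by rewrite /K; have := enorm_ge0 (T x); have := normr_ge0 M; lra.
have resolvent t : 0 < t <= 1 -> exists y v, [/\ H y v, enorm (y - x) <= t * K &
    enorm (v - q) <= enorm (T y - T x)].
  move=> /andP[t0 t1]; have [y [v [Hyv E]]] := minty (x + t *: q) maxH ne t0.
  have tv : t *: (v - q) = x - y.
    by rewrite scalerBr -(addrK y (t *: v)) E addrAC addrK.
  have yx : enorm (y - x) = t * enorm (v - q).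
    by rewrite enormB -tv enormZ gtr0_norm.
  have vTy : enorm (v - q) <= enorm (T y - T x).
    have [->|vq] := eqVneq (enorm (v - q)) 0; first exact: enorm_ge0.
    have vq0 : 0 < enorm (v - q) by rewrite lt0r vq enorm_ge0.
    have yxE : y - x = - t *: (v - q) by rewrite scaleNr tv opprB.
    have := rel _ _ Hyv; rewrite yxE !dotZr -enorm_sqr => h.
    have h2 : enorm (v - q) ^+ 2 <= - dot (T y - T x) (v - q).
      by rewrite -subr_ge0 -(pmulr_rge0 _ t0); lra.
    have := dot_le_enorm (T y - T x) (- (v - q)); rewrite dotNr enormN => h3.
    by rewrite -(ler_pM2r vq0) -expr2 (le_trans h2).
  (* Comparison with the fixed graph point (y0, v0) confines y to a ball independent of t, on which
     T is bounded by M. *)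
  have yy0 : enorm (y - y0) <= r0.
    have := mH _ _ _ _ Hyv H0; rewrite -(pmulr_rge0 _ t0) -dotZl.
    have -> : t *: (v - v0) = (x - y0 + t *: (q - v0)) - (y - y0).
      rewrite -[v - v0](subrKA q) scalerDr tv [RHS]addrAC; congr (_ + _).
      by rewrite opprB addrA subrK.
    rewrite dotBl -enorm_sqr subr_ge0 => h.
    have [->|yy] := eqVneq (enorm (y - y0)) 0.
      by rewrite addr_ge0 ?enorm_ge0.
    have yy0 : 0 < enorm (y - y0) by rewrite lt0r yy enorm_ge0.
    rewrite -(ler_pM2r yy0) -expr2 (le_trans h)// (le_trans (dot_le_enorm _ _))//.
    rewrite ler_wpM2r ?enorm_ge0// (le_trans (enormD _ _))// lerD2l enormZ gtr0_norm//.
    by rewrite ler_piMl ?enorm_ge0.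
  exists y, v; split => //; rewrite yx ler_pM2l//.
  apply: (le_trans vTy); apply: (le_trans (enormD _ _)); rewrite enormN /K.
  have := hM y yy0; have := ler_norm M; lra.
apply: maximal_monotone_mem => // y w yw.
apply: (@ge0_limit _ (2 * enorm (y - x) + enorm (w - q) + 2)) => e /andP[e0 e1].
have [r r1 hr] := near_enorm_lt (cT x) e0.
(* This t brings the resolvent point within e of x, and within the radius where T varies by less
   than e. *)
pose t := Num.min 1 (Num.min e (r / 2) / K).
have t0 : 0 < t by rewrite lt_min ltr01/= divr_gt0// lt_min e0/= divr_gt0.
have t1 : t <= 1 by rewrite ge_min lexx.
have tK : t * K <= Num.min e (r / 2).
  by rewrite -ler_pdivlMr// ge_min lexx orbT.
have tKe : t * K <= e by apply: (le_trans tK); rewrite ge_min lexx.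
have tKr : t * K <= r / 2 by apply: (le_trans tK); rewrite ge_min lexx orbT.
have t01 : 0 < t <= 1 by rewrite t0.
have [y' [v' [Hy' y'x v'q]]] := resolvent t t01.
have {}v'q : enorm (v' - q) <= e.
  by apply: (le_trans v'q); apply: ltW; apply: hr; apply: (le_lt_trans y'x); lra.
have {}y'x := le_trans y'x tKe.
have := mH _ _ _ _ yw Hy'.
have -> : w - v' = (w - q) - (v' - q) by rewrite opprB addrA subrK.
have -> : y - y' = (y - x) - (y' - x) by rewrite opprB addrA subrK.
move: y'x v'q; move: (w - q) (v' - q) (y - x) (y' - x) => a b c f fe be.
rewrite dotBl !dotBr.
have h1 := ler_norm_dot a f; have h2 := ler_norm_dot b c; have h3 := ler_norm_dot b f.
rewrite !ler_norml in h1 h2 h3.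
move: h1 h2 h3 => /andP[h1 _] /andP[h2 h2'] /andP[_ h3].
have a0 := enorm_ge0 a; have b0 := enorm_ge0 b; have c0 := enorm_ge0 c.
have f0 := enorm_ge0 f.
have k1 := ler_wpM2l a0 fe; have k2 := ler_wpM2r c0 be.
have k3 := ler_pM b0 f0 be fe.
have : e * e <= e by rewrite ler_piMl// ltW.
nra.
Qed.

Lemma inclusion_solvable H T c y : maximal_monotone H -> (exists x v, H x v) ->
  (forall x, {for x, continuous T}) -> (forall x y, 0 <= dot (T x - T y) (x - y)) ->
  0 < c -> exists x v, H x v /\ c *: T x + c *: v + x = y.
Proof.
move=> maxH ne cT mT c0.
have [|x [w [xw E]]] := minty y (maximal_monotone_add maxH ne cT mT) _ c0.
  by have [x [v xv]] := ne; exists x, (v + T x); rewrite /= addrK.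
by exists x, (w - T x); split => //; rewrite -scalerDr (addrC (T x)) subrK.
Qed.

End Minty.

(** * The energy invariant *)

Section AnchoredExtragradient.
Context {R : realType} {d : nat}.
Notation V := 'rV[R]_d.

Lemma rho_gt0 : 0 < rho :> R.
Proof. by rewrite invr_gt0 sqrtr_gt0 ltr0n. Qed.

Lemma rho_sqr : rho ^+ 2 = 2^-1 :> R.
Proof. by rewrite /rho exprVn sqr_sqrtr ?ler0n. Qed.

Lemma rho_bounds : 7 / 10 <= (rho : R) <= 1.
Proof. by apply/andP; have := rho_gt0; have := rho_sqr; split; nra. Qed.

Lemma rho_div_sqrt2 : rho / Num.sqrt 2 = 2^-1 :> R.
Proof. by rewrite -rho_sqr expr2. Qed.

(** Eliminating Z from the monotonicity inequality leaves a slack of exactly |A w - (A + a) w' +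
    f|^2 / 2 - |f|^2, nonnegative by the last hypothesis. *)
Lemma anchored_step (A a : R) (w w' Z X f : V) :
  0 <= A -> 0 < a ->
  A *: Z = (A + a) *: X + a *: ((A + a) *: w' - f) ->
  0 <= dot (w' - w) (X - Z) ->
  2 * dot f f <= enorm (A *: w - (A + a) *: w' + f) ^+ 2 ->
  (A + a) * dot w' X + (A + a) ^+ 2 * dot w' w' / 2 + dot f f / 2 <=
  A * dot w Z + A ^+ 2 * dot w w / 2.
Proof.
move=> A0 a0 E mono ff.
have EZ u : A * dot u Z = (A + a) * dot u X + a * ((A + a) * dot u w' - dot u f).
  by rewrite -dotZr E !dotE.
have := mulr_ge0 A0 mono; rewrite dotBl !dotBr => h1.
have E' := EZ w'; have Ew := EZ w.
have h2 : 0 <= a * (dot w X - dot w' X - (A + a) * dot w' w' + dot w' f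
    + (A + a) * dot w w' - dot w f) by nra.
rewrite pmulr_rge0// in h2.
have Aa : 0 <= A + a by lra.
have h3 := mulr_ge0 Aa h2.
move: ff; rewrite enorm_sqr !dotE (dotC w' w) (dotC f w) (dotC f w') => ff.
rewrite Ew.
clear -ff h3; nra.
Qed.

(** With f = ((A + a) / a) e, the vector A w - (A + a) w' + f is (A + a) / a times the displacement
    of x from the extrapolated point. The relative error criterion with rho^2 = 1/2 is thus the
    hypothesis of [anchored_step]. *)
Lemma anchored_energy (A a : R) (z0 z w w' x e : V) :
  0 <= A -> 0 < a ->
  a *: w' + x = (a / (A + a)) *: z0 + (A / (A + a)) *: z + e ->
  0 <= dot (w' - w) (x - z) ->
  enorm e <= rho *
    enorm (x - ((a / (A + a)) *: z0 + (A / (A + a)) *: (z - a *: w))) ->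
  (A + a) * dot w' (x - z0) + (A + a) ^+ 2 * dot w' w' / 2
    + ((A + a) / a * enorm e) ^+ 2 / 2 <=
  A * dot w (z - z0) + A ^+ 2 * dot w w / 2.
Proof.
move=> A0 a0 E0 mono ee.
have xE : x = (a / (A + a)) *: z0 + (A / (A + a)) *: z + e - a *: w'.
  by rewrite -E0 addrAC subrr add0r.
have Aa : 0 < A + a by rewrite ltr_wpDl.
have a0' : a != 0 by rewrite gt_eqF.
have Aa' : A + a != 0 by rewrite gt_eqF.
pose f := ((A + a) / a) *: e.
have EZ : A *: (z - z0) = (A + a) *: (x - z0) + a *: ((A + a) *: w' - f).
  by rewrite xE /f; apply/rowP => i; rewrite !mxE; field; rewrite ?a0' ?Aa'.
have mono' : 0 <= dot (w' - w) (x - z0 - (z - z0)) by rewrite opprB addrA subrK.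
have gE : A *: w - (A + a) *: w' + f = ((A + a) / a) *:
    (x - ((a / (A + a)) *: z0 + (A / (A + a)) *: (z - a *: w))).
  by rewrite xE /f; apply/rowP => i; rewrite !mxE; field; rewrite ?a0' ?Aa'.
have c0 : 0 <= (A + a) / a by rewrite divr_ge0 ?ltW.
have ff : 2 * dot f f <= enorm (A *: w - (A + a) *: w' + f) ^+ 2.
  rewrite -enorm_sqr gE /f !enormZ ger0_norm//.
  have := ler_wpM2l c0 ee; rewrite mulrCA.
  move: (_ * enorm e) (mulr_ge0 c0 (enorm_ge0 e)) (_ * enorm (_ - _)) => s s0 t st.
  have : s ^+ 2 <= (rho * t) ^+ 2 by rewrite ler_sqr ?nnegrE// (le_trans s0).
  by rewrite exprMn rho_sqr; lra.
have := anchored_step A0 a0 EZ mono' ff.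
by rewrite -[dot f f]enorm_sqr enormZ ger0_norm.
Qed.

Lemma resolvent_nonexpansive (H : V -> set V) (T : V -> V) (c : R) x1 v1 y1 x2 v2 y2 :
  monotone_op H -> (forall x y, 0 <= dot (T x - T y) (x - y)) -> 0 <= c ->
  H x1 v1 -> H x2 v2 ->
  c *: T x1 + c *: v1 + x1 = y1 -> c *: T x2 + c *: v2 + x2 = y2 ->
  enorm (x1 - x2) <= enorm (y1 - y2).
Proof.
move=> mH mT c0 h1 h2 <- <-.
have := mulr_ge0 c0 (mH _ _ _ _ h1 h2); have := mulr_ge0 c0 (mT x1 x2).
rewrite -!dotZl.
have -> : c *: T x1 + c *: v1 + x1 - (c *: T x2 + c *: v2 + x2) =
    c *: (T x1 - T x2) + c *: (v1 - v2) + (x1 - x2).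
  by rewrite !scalerBr; apply/rowP => i; rewrite !mxE; ring.
move: (c *: (T x1 - T x2)) (c *: (v1 - v2)) (x1 - x2) => s t x hs ht.
have [->|x0] := eqVneq (enorm x) 0; first exact: enorm_ge0.
have x1' : 0 < enorm x by rewrite lt0r x0 enorm_ge0.
rewrite -(ler_pM2r x1') -expr2 (le_trans _ (dot_le_enorm _ _))//.
by rewrite enorm_sqr !dotDl; lra.
Qed.

End AnchoredExtragradient.

(** * Trial points and the invariant along the iterations *)

Section Algorithm.
Context {R : realType} {d : nat}.
Notation V := 'rV[R]_d.
Variables (q : nat) (F : V -> V) (H : V -> set V) (L eps : R) (z0 zstar : V).
Hypotheses (q_gt0 : (0 < q)%N) (F_mono : monotone_op (fun z => [set F z])).
Hypotheses (CF : continuously_differentiable q F) (L_gt0 : 0 < L).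
Hypothesis LF : forall z z' : V,
  (op_norm (fun hs : q.-tuple V => (iter_diff F hs z - iter_diff F hs z')%R)
     <= (L * enorm (z - z'))%:E)%E.
Hypotheses (maxH : maximal_monotone H) (zstarH : H zstar (- F zstar)).
Hypothesis eps_gt0 : 0 < eps.

Local Notation T := (model q F L).
Local Notation D := (enorm (z0 - zstar)).
Implicit Types (s : state (R := R) (d := d)) (a b : R).

Local Notation w s := (F (st_z s) + st_v s).
Local Notation y := (anchor z0).
Local Notation h := (z_half F z0).
Local Notation x := (z_next q.+1 F H L z0).
Local Notation r s a := (enorm (x s a - h s a)).
Local Notation psi := (merit q.+1 F H L z0).

Let mT c u v : 0 <= dot (T c u - T c v) (u - v).
Proof. exact: (model_monotone q_gt0 F_mono CF L_gt0 LF). Qed.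

Let D_ge0 : 0 <= D := enorm_ge0 _.

(** Existence of a solution guarantees that [xget] selects one instead of its default; [zstar]
    witnesses that the graph of H is nonempty. *)
Lemma z_nextP s a : 0 < a ->
  exists v, H (x s a) v /\ a *: T (h s a) (x s a) + a *: v + x s a = y s a.
Proof.
move=> a0.
have cT c u : {for u, continuous (T c)}.
  by apply: (continuous_model CF (f := id)); exact: cvg_id.
have [u [v [uv E]]] := inclusion_solvable (y s a) maxH
  (ex_intro _ zstar (ex_intro _ (- F zstar) zstarH)) (cT (h s a)) (mT (h s a)) a0.
have [v' xv' E'] : subproblem q.+1 F H L z0 s a (x s a).
  apply: xgetPex; exists u, v => //.
  by rewrite /P_model -/(T (h s a) u) E subrr.
by exists v'; split => //; apply/eqP; rewrite -subr_eq0; apply/eqP.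
Qed.

Lemma v_nextP s a : 0 < a -> H (x s a) (v_next q.+1 F H L z0 s a).
Proof.
move=> a0; have [v [xv E]] := z_nextP s a0.
have a0' : a != 0 by rewrite gt_eqF.
suff -> : v_next q.+1 F H L z0 s a = v by [].
rewrite /v_next -E addrK scalerDr !scalerA mulVf// !scale1r.
by rewrite addrC addKr.
Qed.

Lemma v_next_eq s a : 0 < a ->
  a *: T (h s a) (x s a) + a *: v_next q.+1 F H L z0 s a + x s a = y s a.
Proof.
move=> a0; have a0' : a != 0 by rewrite gt_eqF.
rewrite /v_next scalerBr scalerA divff// scale1r.
change (P_model _ _ _ _ _ _ _) with (T (h s a) (x s a)).
move: (T (h s a) (x s a)) (x s a) (y s a) => t u v.
by apply/rowP => i; rewrite !mxE; ring.
Qed.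

Definition invariant s :=
  [/\ 0 <= st_A s, H (st_z s) (st_v s),
      st_A s * dot (w s) (st_z s - z0) + st_A s ^+ 2 * dot (w s) (w s) / 2 <= 0 &
      enorm (st_z s - zstar) <= 2 * D].

Lemma residual_monotone u v : H u v -> 0 <= dot (F u + v) (u - zstar).
Proof.
move=> uv; have := maxH.1 _ _ _ _ uv zstarH.
have := F_mono (x := u) (y := zstar) erefl erefl.
by rewrite !dotBl !dotDl dotNl; lra.
Qed.

(** Monotonicity at the zero [zstar] bounds the linear term of the energy below by - A |w| D,
    leaving A^2 |w|^2 / 2 <= A |w| D. *)
Lemma invariant_residual s : invariant s -> st_A s * enorm (w s) <= 2 * D.
Proof.
move=> [A0 zv E _]; have := residual_monotone zv.
have -> : st_z s - zstar = (st_z s - z0) + (z0 - zstar) by rewrite addrA subrK.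
rewrite dotDr => h1; have := dot_le_enorm (w s) (z0 - zstar) => h2.
have [->|W0] := eqVneq (st_A s * enorm (w s)) 0; first by rewrite mulr_ge0.
have {}W0 : 0 < st_A s * enorm (w s) by rewrite lt0r W0 mulr_ge0 ?enorm_ge0.
rewrite -(ler_pM2r W0); move: E; rewrite -enorm_sqr => E.
have h3 := mulr_ge0 A0 h1; have h4 := ler_wpM2l A0 h2.
nra.
Qed.

Lemma y_zstar s a : invariant s -> 0 < a -> enorm (y s a - zstar) <= 2 * D.
Proof.
move=> [A0 _ _ zD] a0; have Aa : 0 < st_A s + a by rewrite ltr_wpDl.
have -> : y s a - zstar = (a / (st_A s + a)) *: (z0 - zstar) +
    (st_A s / (st_A s + a)) *: (st_z s - zstar).
  rewrite /anchor !scalerBr addrACA -opprD -scalerDl -mulrDl addrC.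
  by rewrite [a + _]addrC divff ?gt_eqF// scale1r addrC.
apply: (le_trans (enormD _ _)).
rewrite !enormZ !ger0_norm ?divr_ge0 ?invr_ge0 ?(ltW a0) ?(ltW Aa)//.
have -> : 2 * D = a / (st_A s + a) * (2 * D) + st_A s / (st_A s + a) * (2 * D).
  by field; rewrite gt_eqF.
rewrite lerD// ler_wpM2l ?divr_ge0 ?invr_ge0 ?(ltW a0) ?(ltW Aa)//.
by have := D_ge0; lra.
Qed.

Lemma y_sub_h s a : y s a - h s a = (st_A s / (st_A s + a) * a) *: w s.
Proof.
rewrite /anchor /z_half scalerBr scalerA opprD addrACA subrr add0r opprB.
by rewrite addrCA subrr addr0.
Qed.

Lemma y_h s a : invariant s -> 0 < a -> enorm (y s a - h s a) <= 2 * D.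
Proof.
move=> inv a0; have [A0 _ _ _] := inv; have Aa : 0 < st_A s + a by rewrite ltr_wpDl.
rewrite y_sub_h enormZ ger0_norm ?mulr_ge0 ?divr_ge0 ?invr_ge0 ?(ltW a0) ?(ltW Aa)//.
apply: le_trans (invariant_residual inv).
rewrite ler_wpM2r ?enorm_ge0// mulrAC ler_pdivrMr//.
by rewrite ler_wpM2l//; lra.
Qed.

Lemma h_zstar s a : invariant s -> 0 < a -> enorm (h s a - zstar) <= 4 * D.
Proof.
move=> inv a0; have := y_h inv a0; have := y_zstar inv a0.
have := enorm_distD (h s a) (y s a) zstar; rewrite (enormB (h s a) (y s a)); lra.
Qed.

Lemma MpE : Mp q.+1 L = q.+2%:R * L.
Proof. by rewrite /Mp /lambda -[q.+2%:R]natr1; ring. Qed.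

Lemma invariant_next s a : invariant s -> 0 < a ->
  psi s a <= q.+1`!%:R * rho -> invariant (next_state q.+1 F H L z0 s a).
Proof.
move=> inv a0 psia; have [A0 zv E zD] := inv.
have Aa : 0 < st_A s + a by rewrite ltr_wpDl.
have xv := v_nextP s a0; have xE := v_next_eq s a0.
have mono : 0 <= dot (F (x s a) + v_next q.+1 F H L z0 s a - w s) (x s a - st_z s).
  have := maxH.1 _ _ _ _ xv zv; have := F_mono (x := x s a) (y := st_z s) erefl erefl.
  by move: (v_next _ _ _ _ _ _ _) => v; rewrite !dotBl !dotDl; lra.
(* Replacing the model by F turns the subproblem into an exact resolvent identity for F + H with
   error e. *)
pose e := a *: (F (x s a) - T (h s a) (x s a)).
have eE : a *: (F (x s a) + v_next q.+1 F H L z0 s a) + x s a = y s a + e.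
  rewrite -xE /e; move: (T _ _) (v_next _ _ _ _ _ _ _) => t v.
  by apply/rowP => i; rewrite !mxE; ring.
have ee : enorm e <= rho * r s a.
  rewrite /e enormZ (gtr0_norm a0).
  have := model_error CF L_gt0 LF (h s a) (x s a); rewrite enormB => me.
  apply: (le_trans (ler_wpM2l (ltW a0) me)).
  have f0 : 0 < q.+1`!%:R :> R by rewrite ltr0n fact_gt0.
  have -> : a * ((L + q.+1%:R * L) / q.+1`!%:R * r s a ^+ q.+1) =
      psi s a / q.+1`!%:R * r s a.
    by rewrite /merit /Mp /lambda /= exprSr; ring.
  by rewrite ler_wpM2r ?enorm_ge0// ler_pdivrMr// mulrC.
have step := anchored_energy A0 a0 eE mono ee.
have w'0 := residual_monotone xv.
set w' := F (x s a) + _ in step w'0 eE.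
clearbody e.
have xz0 : x s a - z0 = (x s a - zstar) - (z0 - zstar) by rewrite opprB addrA subrK.
have h1 := dot_le_enorm w' (z0 - zstar).
split => //=; first exact: ltW.
  rewrite -/w'; apply: le_trans E; apply: le_trans step.
  by rewrite lerDl divr_ge0 ?sqr_ge0.
(* The error term retained in the energy decrease is at most (A + a) |w'| D - (A + a)^2 |w'|^2 / 2
   <= D^2 / 2. *)
have fD : (st_A s + a) / a * enorm e <= D.
  rewrite -(@ler_sqr R) ?nnegrE ?enorm_ge0 ?mulr_ge0 ?invr_ge0 ?enorm_ge0 ?(ltW a0) ?(ltW Aa)//.
  move: step; rewrite xz0 dotBr -enorm_sqr => step.
  have h2 := ler_wpM2l (ltW Aa) h1; have h3 := mulr_ge0 (ltW Aa) w'0.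
  have := sqr_ge0 ((st_A s + a) * enorm w' - D); rewrite sqrrB exprMn => h4.
  lra.
(* Paired with x - zstar, the term in w' is nonnegative, and the right side is at most (a D + 2 A D
   + a D) |x - zstar|. *)
have xzE : (st_A s + a) *: (x s a - zstar) + ((st_A s + a) * a) *: w' =
    a *: (z0 - zstar) + st_A s *: (st_z s - zstar) + (st_A s + a) *: e.
  have -> : x s a = y s a + e - a *: w' by rewrite -eE addrC addKr.
  have gen (z e' u : V) : (st_A s + a) *: ((a / (st_A s + a)) *: z0 +
      (st_A s / (st_A s + a)) *: z + e' - a *: u - zstar) + ((st_A s + a) * a) *: u =
      a *: (z0 - zstar) + st_A s *: (z - zstar) + (st_A s + a) *: e'.
    by apply/rowP => i; rewrite !mxE; field; rewrite gt_eqF.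
  exact: gen.
have [->|xz] := eqVneq (enorm (x s a - zstar)) 0; first by rewrite mulr_ge0.
have xz' : 0 < enorm (x s a - zstar) by rewrite lt0r xz enorm_ge0.
rewrite -(ler_pM2l Aa) -(ler_pM2r xz').
clearbody w'.
have := congr1 (fun u => dot u (x s a - zstar)) xzE.
rewrite /= !dotDl !dotZl -enorm_sqr => h2.
have d1 := ler_wpM2l (ltW a0) (dot_le_enorm (z0 - zstar) (x s a - zstar)).
have d2 := ler_wpM2l A0 (dot_le_enorm (st_z s - zstar) (x s a - zstar)).
have d3 := ler_wpM2l (ltW Aa) (dot_le_enorm e (x s a - zstar)).
have d4 := mulr_ge0 (mulr_ge0 (ltW Aa) (ltW a0)) w'0.
have d5 : (st_A s + a) * enorm e <= a * D by rewrite -ler_pdivrMl// mulrCA mulrA.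
have d6 := ler_wpM2r (ltW xz') d5.
have d7 := ler_wpM2l A0 (ler_wpM2r (ltW xz') zD).
have -> : (st_A s + a) * (2 * D) * enorm (x s a - zstar) =
  st_A s * (2 * D * enorm (x s a - zstar)) + 2 * (a * D * enorm (x s a - zstar)) by ring.
lra.
Qed.

Lemma invariant_init v0 : H z0 v0 -> invariant (State z0 v0 0).
Proof.
move=> zv; split => //=; first by rewrite mul0r expr0n /= !mul0r addr0.
by have := D_ge0; lra.
Qed.

Lemma bisection_between s lo hi n a : bisection q.+1 F H L z0 s lo hi n a ->
  lo < hi -> lo < a < hi /\ psi s a <= q.+1`!%:R * rho.
Proof.
elim=> {lo hi n a} [lo hi /andP[_ ?]|lo hi n a _ _ IH|lo hi n a _ _ IH] lh.
- by split => //; rewrite /mid; apply/andP; split; lra.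
- have /IH[/andP[h1 h2] h3] : mid lo hi < hi by rewrite /mid; lra.
  by split => //; rewrite h2 andbT (lt_trans _ h1)// /mid; lra.
- have /IH[/andP[h1 h2] h3] : lo < mid lo hi by rewrite /mid; lra.
  by split => //; rewrite h1 (lt_trans h2)// /mid; lra.
Qed.

Lemma upper_trial_gt0 s : 0 < upper_trial q.+1 F L eps s.
Proof.
rewrite /upper_trial lt_max; apply/orP; right; apply: powR_gt0.
rewrite mulr_gt0 ?powR_gt0 ?divr_gt0 ?mulr_gt0 ?ltr0n ?fact_gt0 ?rho_gt0//.
- by have := @rho_gt0 R; lra.
- by rewrite MpE mulr_gt0.
Qed.

Lemma invoked_reached k s : line_search_invoked q.+1 F H L eps z0 k s ->
  reached q.+1 F H L eps z0 k s.
Proof. by case. Qed.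

Lemma reached_invariant k s : reached q.+1 F H L eps z0 k s -> invariant s.
Proof.
elim: k s => [|k IH] s hs; inversion hs as [v0 zv|k' s0 n a hi hl]; subst.
  exact: invariant_init.
have inv : invariant s0 by apply: IH; exact: invoked_reached.
inversion hl as [|m a' _ hb]; subst.
have [/andP[a0 _] pa] := bisection_between hb (upper_trial_gt0 s0).
exact: invariant_next.
Qed.

(* zstar solves the subproblem for the input zstar + a (T zstar - F zstar). *)
Lemma x_zstar s a : invariant s -> 0 < a ->
  enorm (x s a - zstar) <= 2 * D + a * (q.+2%:R * L) * (4 * D) ^+ q.+1.
Proof.
move=> inv a0; have xv := v_nextP s a0; have xE := v_next_eq s a0.
have zE : a *: T (h s a) zstar + a *: (- F zstar) + zstar =
    zstar + a *: (T (h s a) zstar - F zstar).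
  by rewrite -scalerDr addrC.
apply: (le_trans (resolvent_nonexpansive maxH.1 (mT (h s a)) (ltW a0) xv zstarH xE zE)).
rewrite opprD addrA; apply: (le_trans (enormD _ _)); rewrite lerD//; first exact: y_zstar.
rewrite enormN enormZ (gtr0_norm a0) -mulrA ler_wpM2l ?(ltW a0)//.
apply: (le_trans (model_error CF L_gt0 LF (h s a) zstar)).
have -> : L + q.+1%:R * L = q.+2%:R * L by rewrite -[q.+2%:R]natr1; ring.
have Q0 : 0 <= q.+2%:R * L by rewrite mulr_ge0 ?ler0n// ltW.
apply: ler_pM; rewrite ?exprn_ge0 ?enorm_ge0 ?divr_ge0 ?ler0n//.
  by rewrite ler_pdivrMr ?ltr0n ?fact_gt0// ler_peMr// ler1n fact_gt0.
rewrite lerXn2r ?nnegrE ?enorm_ge0 ?mulr_ge0//.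
by rewrite enormB; exact: h_zstar.
Qed.

(** * Radius of a trial and size of a step with large merit *)

Definition merit_above s a : Prop := q.+1`!%:R * rho < psi s a.

Definition merit_below s a : Prop := psi s a < q.+1`!%:R * rho / Num.sqrt 2.

(** 6 = 2 + 4 collects the bounds 2 D for y and 4 D for h; the other term is the model error at
    [zstar], where |h - zstar| <= 4 D. *)
Definition radius_const : R := 6 + q.+2%:R * 4 ^+ q.+1.
Local Notation K1 := radius_const.
Local Notation X a := (a * L * D ^+ q).

Lemma radius_const_ge6 : 6 <= K1.
Proof. by rewrite /radius_const lerDl mulr_ge0 ?exprn_ge0 ?ler0n. Qed.

Lemma X_ge0 a : 0 <= a -> 0 <= X a.
Proof. by move=> a0; rewrite !mulr_ge0 ?exprn_ge0// ltW. Qed.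

Lemma radius_bound s a : invariant s -> 0 < a -> r s a <= K1 * D * (1 + X a).
Proof.
move=> inv a0; have := x_zstar inv a0; have := h_zstar inv a0.
have := enorm_distD (x s a) zstar (h s a); rewrite (enormB zstar (h s a)).
have -> : a * (q.+2%:R * L) * (4 * D) ^+ q.+1 = q.+2%:R * 4 ^+ q.+1 * D * X a.
  by rewrite exprMn [D ^+ q.+1]exprS; ring.
have -> : K1 * D * (1 + X a) = 6 * D + 6 * D * X a + q.+2%:R * 4 ^+ q.+1 * D
    + q.+2%:R * 4 ^+ q.+1 * D * X a by rewrite /radius_const; ring.
have : 0 <= 6 * D * X a by apply: mulr_ge0; [rewrite mulr_ge0|rewrite X_ge0// ltW].
have : 0 <= q.+2%:R * 4 ^+ q.+1 * D by rewrite !mulr_ge0 ?exprn_ge0 ?ler0n.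
move: (q.+2%:R * _ * D * X a) => t; lra.
Qed.

Lemma x_y_bound s a : invariant s -> 0 < a ->
  enorm (y s a - x s a) <= K1 * D * (1 + X a).
Proof.
move=> inv a0; have := x_zstar inv a0; have := y_zstar inv a0.
have := enorm_distD (y s a) zstar (x s a); rewrite (enormB zstar (x s a)).
have -> : a * (q.+2%:R * L) * (4 * D) ^+ q.+1 = q.+2%:R * 4 ^+ q.+1 * D * X a.
  by rewrite exprMn [D ^+ q.+1]exprS; ring.
have -> : K1 * D * (1 + X a) = 6 * D + 6 * D * X a + q.+2%:R * 4 ^+ q.+1 * D
    + q.+2%:R * 4 ^+ q.+1 * D * X a by rewrite /radius_const; ring.
have : 0 <= 6 * D * X a by apply: mulr_ge0; [rewrite mulr_ge0|rewrite X_ge0// ltW].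
have : 0 <= q.+2%:R * 4 ^+ q.+1 * D by rewrite !mulr_ge0 ?exprn_ge0 ?ler0n.
have := D_ge0; move: (q.+2%:R * _ * D * X a) => t; lra.
Qed.

Definition low_const : R := (2 * q.+2%:R * (2 * K1) ^+ q)^-1.

Lemma low_const_gt0 : 0 < low_const.
Proof.
have := radius_const_ge6 => K6.
by rewrite invr_gt0 mulr_gt0 ?mulr_gt0 ?exprn_gt0 ?ltr0n//; lra.
Qed.

(** If X b < 1, the radius is at most 2 K1 D and the merit at most (q + 2) (2 K1)^q X b, while the
    threshold is at least 1/2. *)
Lemma merit_large s b : invariant s -> 0 < b ->
  merit_above s b -> low_const <= X b.
Proof.
move=> inv b0 pb; have rb := radius_bound inv b0; have K6 := radius_const_ge6.
have X0 := X_ge0 (ltW b0).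
have [X1|X1] := lerP 1 (X b).
  apply: le_trans X1; rewrite /low_const invf_le1.
    rewrite -[1]mulr1 ler_pM// ?exprn_ege1//; last by lra.
    have : 1 <= q.+2%:R :> R by rewrite ler1n.
    by lra.
  by rewrite mulr_gt0 ?mulr_gt0 ?exprn_gt0 ?ltr0n//; lra.
have r2 : r s b <= 2 * K1 * D.
  have KD : 0 <= K1 * D by rewrite mulr_ge0//; lra.
  by apply: (le_trans rb); nra.
have rq : r s b ^+ q <= (2 * K1) ^+ q * D ^+ q.
  rewrite -exprMn lerXn2r ?nnegrE ?enorm_ge0// mulr_ge0//; lra.
have half : 2^-1 <= q.+1`!%:R * rho :> R.
  have /andP[rh _] := @rho_bounds R.
  have f1 : 1 <= q.+1`!%:R :> R by rewrite ler1n fact_gt0.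
  by nra.
have M0 : 0 <= Mp q.+1 L * b by rewrite MpE !mulr_ge0 ?ler0n ?ltW.
have := le_lt_trans half pb; rewrite /merit /= => h1.
have := lt_le_trans h1 (ler_wpM2l M0 rq); rewrite MpE => h2.
rewrite /low_const -(@ler_pM2l _ (2 * q.+2%:R * (2 * K1) ^+ q)); last first.
  by rewrite mulr_gt0 ?mulr_gt0 ?exprn_gt0 ?ltr0n//; lra.
rewrite divff ?gt_eqF//; last first.
  by rewrite mulr_gt0 ?mulr_gt0 ?exprn_gt0 ?ltr0n//; lra.
have -> : 2 * q.+2%:R * (2 * K1) ^+ q * X b =
  2 * (q.+2%:R * L * b * ((2 * K1) ^+ q * D ^+ q)) by ring.
lra.
Qed.

(** The bound is uniform in A, at the price of measuring the step change relative to b. *)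
Lemma anchor_weight_diff (A a b : R) : 0 <= A -> 0 < a -> a < b ->
  0 <= b / (A + b) - a / (A + a) <= (b - a) / b.
Proof.
move=> A0 a0 ab; have b0 : 0 < b by lra.
have Aa : 0 < A + a by lra. have Ab : 0 < A + b by lra.
have -> : b / (A + b) - a / (A + a) = (b - a) / (A + b) * (A / (A + a)).
  by field; rewrite !gt_eqF.
have h1 : (b - a) / (A + b) <= (b - a) / b.
  by rewrite ler_wpM2l ?lef_pV2 ?posrE//; lra.
have h2 : 0 <= (b - a) / (A + b) by rewrite divr_ge0 ?ltW//; lra.
have h3 : 0 <= A / (A + a) by rewrite divr_ge0// ltW.
have h4 : A / (A + a) <= 1 by rewrite ler_pdivrMr//; lra.
by apply/andP; split; [rewrite mulr_ge0|apply: le_trans h1; rewrite ler_piMr].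
Qed.

Lemma z0_z s : invariant s -> enorm (z0 - st_z s) <= 3 * D.
Proof.
by move=> [_ _ _ zD]; have := enorm_distD z0 zstar (st_z s); rewrite (enormB zstar); lra.
Qed.

Lemma y_diff s a b : invariant s -> 0 < a -> a < b ->
  enorm (y s b - y s a) <= 3 * D * ((b - a) / b).
Proof.
move=> inv a0 ab; have [A0 _ _ _] := inv.
have /andP[d0 d1] := anchor_weight_diff A0 a0 ab.
have -> : y s b - y s a =
    (b / (st_A s + b) - a / (st_A s + a)) *: (z0 - st_z s).
  have Aa : st_A s + a != 0 by rewrite gt_eqF//; lra.
  have Ab : st_A s + b != 0 by rewrite gt_eqF//; lra.
  by rewrite /anchor; apply/rowP => i; rewrite !mxE; field; rewrite Aa Ab.
rewrite enormZ ger0_norm// mulrC; apply: ler_pM; rewrite ?enorm_ge0//.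
exact: z0_z.
Qed.

(** The extrapolation a A / (A + a) varies like A times the anchor weight, so A |w| <= 2 D adds 2 to
    the constant 3 of [y_diff]. *)
Lemma h_diff s a b : invariant s -> 0 < a -> a < b ->
  enorm (h s b - h s a) <= 5 * D * ((b - a) / b).
Proof.
move=> inv a0 ab; have [A0 _ _ _] := inv.
have /andP[d0 d1] := anchor_weight_diff A0 a0 ab.
have -> : h s b - h s a = (y s b - y s a) -
    (b / (st_A s + b) - a / (st_A s + a)) *: (st_A s *: w s).
  have Aa : st_A s + a != 0 by rewrite gt_eqF//; lra.
  have Ab : st_A s + b != 0 by rewrite gt_eqF//; lra.
  rewrite /anchor /z_half; move: (st_z s) (w s) => z u.
  by apply/rowP => i; rewrite !mxE; field; rewrite Aa Ab.
apply: (le_trans (enormD _ _)).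
rewrite enormN enormZ (ger0_norm d0) enormZ (ger0_norm A0).
have := y_diff inv a0 ab; have := ler_pM d0 (mulr_ge0 A0 (enorm_ge0 _)) d1 (invariant_residual inv).
lra.
Qed.

(** * Width of the bisection bracket *)

Opaque z_next z_half v_next taylor_model anchor.

(** 8 = 3 + 5 comes from the motions of y and h, 2 K1 from rescaling the step, and the last term
    from moving the center of the model. *)
Definition lip_const : R := 8 + 2 * K1 + 10 * q.+1%:R * (2 * K1 + 5) ^+ q.

(** The point found with step a also solves the subproblem of step b for a perturbed input; the
    resolvent of step b is nonexpansive. *)
Lemma x_diff s a b : 0 < a -> a < b ->
  enorm (x s b - x s a) <= enorm (y s b - y s a) +
    (b - a) / a * enorm (y s a - x s a) +
    b * enorm (T (h s b) (x s a) - T (h s a) (x s a)).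
Proof.
move=> a0 ab; have b0 := lt_trans a0 ab.
have xvb := v_nextP s b0; have xEb := v_next_eq s b0.
have xva := v_nextP s a0; have xEa := v_next_eq s a0.
have E : b *: T (h s b) (x s a) + b *: v_next q.+1 F H L z0 s a + x s a =
    y s a + ((b - a) / a) *: (y s a - x s a) +
    b *: (T (h s b) (x s a) - T (h s a) (x s a)).
  have a0' : a != 0 by rewrite gt_eqF.
  rewrite -xEa; move: (T (h s b) (x s a)) (T (h s a) (x s a)) (v_next _ _ _ _ _ _ _) => c1 c2 c3.
  move: (x s a) => c4.
  by apply/rowP => i; rewrite !mxE; field.
apply: (le_trans (resolvent_nonexpansive maxH.1 (mT (h s b)) (ltW b0) xvb xva xEb E)).
rewrite !opprD !addrA; apply: (le_trans (enormD _ _)).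
rewrite enormN enormZ (gtr0_norm b0) lerD2r.
apply: (le_trans (enormD _ _)); rewrite enormN enormZ lerD2l ler_wpM2r ?enorm_ge0//.
rewrite ger0_norm//; apply: divr_ge0; last exact: ltW.
by rewrite subr_ge0 ltW.
Qed.

Lemma dist_enorm_le (u1 u2 v1 v2 : V) :
  `|enorm (u1 - v1) - enorm (u2 - v2)| <= enorm (u1 - u2) + enorm (v1 - v2).
Proof.
have e1 : u1 - v1 = (u1 - u2) - (v1 - v2) + (u2 - v2).
  by apply/rowP => i; rewrite !mxE; ring.
have e2 : u2 - v2 = (v1 - v2) - (u1 - u2) + (u1 - v1).
  by apply/rowP => i; rewrite !mxE; ring.
have := enormD ((u1 - u2) - (v1 - v2)) (u2 - v2); rewrite -e1.
have := enormD ((v1 - v2) - (u1 - u2)) (u1 - v1); rewrite -e2.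
have := enormD (u1 - u2) (- (v1 - v2)).
have := enormD (v1 - v2) (- (u1 - u2)); rewrite !enormN.
by rewrite ler_norml => *; apply/andP; split; lra.
Qed.

Lemma r_diff_arith (a b ey eh exy r1 r2 eT ex : R) : 0 < a -> a < b -> b <= 2 * a ->
  ey <= 3 * D * ((b - a) / b) -> 0 <= eh <= 5 * D * ((b - a) / b) ->
  0 <= exy <= K1 * D * (1 + X b) -> 0 <= r1 <= K1 * D * (1 + X b) ->
  0 <= r2 <= r1 + eh ->
  eT <= 2 * q.+1%:R * L * (r1 + r2) ^+ q * eh ->
  ex <= ey + (b - a) / a * exy + b * eT ->
  ex + eh <= lip_const * D * ((b - a) / b) * (1 + X b) ^+ q.+1.
Proof.
move=> a0 ab b2a hy /andP[eh0 hh] /andP[exy0 hxy] /andP[r10 hr1] /andP[r20 hr2] hT hx.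
have b0 : 0 < b by lra.
have K6 := radius_const_ge6; have D0 := D_ge0.
set t := (b - a) / b in hy hh *.
have t0 : 0 <= t by rewrite divr_ge0//; lra.
have t1 : t <= 1 by rewrite ler_pdivrMr//; lra.
have Xb0 := X_ge0 (ltW b0).
set U := 1 + X b in hxy hr1 *; have U1 : 1 <= U by rewrite /U lerDl.
have Uq : 1 <= U ^+ q by rewrite exprn_ege1.
(* The place where b <= 2 a enters. *)
have at2 : (b - a) / a <= 2 * t.
  have tb : t * b = b - a by rewrite /t divfK// gt_eqF.
  rewrite ler_pdivrMr// -tb; have -> : 2 * t * a = t * (2 * a) by ring.
  exact: ler_wpM2l.
have S : r1 + r2 <= (2 * K1 + 5) * D * U.
  have : 5 * D * t <= 5 * D * U by rewrite ler_wpM2l ?mulr_ge0//; lra.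
  lra.
have Sq : (r1 + r2) ^+ q <= (2 * K1 + 5) ^+ q * D ^+ q * U ^+ q.
  rewrite -!exprMn lerXn2r ?nnegrE ?addr_ge0//.
  by rewrite !mulr_ge0//; lra.
have Q0 : 0 <= 2 * q.+1%:R * L by rewrite !mulr_ge0 ?ler0n// ltW.
have S0 : 0 <= (r1 + r2) ^+ q by rewrite exprn_ge0// addr_ge0.
have V1 : 1 <= U * U ^+ q by nra.
have UV : U <= U * U ^+ q by nra.
have C0 : 0 <= 10 * q.+1%:R * (2 * K1 + 5) ^+ q * D * t.
  do 2 (apply: mulr_ge0 => //); apply: mulr_ge0; first by rewrite mulr_ge0 ?ler0n.
  by rewrite exprn_ge0//; lra.
have bT : b * eT <= 10 * q.+1%:R * (2 * K1 + 5) ^+ q * D * t * (U * U ^+ q).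
  apply: (le_trans (ler_wpM2l (ltW b0) hT)).
  have h1 : (r1 + r2) ^+ q * eh <= (2 * K1 + 5) ^+ q * D ^+ q * U ^+ q * (5 * D * t).
    exact: ler_pM.
  have := ler_wpM2l (mulr_ge0 (ltW b0) Q0) h1.
  have -> : b * (2 * q.+1%:R * L) * ((r1 + r2) ^+ q * eh) =
    b * (2 * q.+1%:R * L * (r1 + r2) ^+ q * eh) by ring.
  move=> /le_trans; apply.
  have -> : b * (2 * q.+1%:R * L) * ((2 * K1 + 5) ^+ q * D ^+ q * U ^+ q * (5 * D * t)) =
    10 * q.+1%:R * (2 * K1 + 5) ^+ q * D * t * (X b * U ^+ q) by ring.
  by rewrite ler_wpM2l// ler_wpM2r ?exprn_ge0// /U; lra.
have h2 : (b - a) / a * exy <= 2 * t * (K1 * D * (U * U ^+ q)).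
  apply: ler_pM => //; first by rewrite divr_ge0//; lra.
  by apply: (le_trans hxy); rewrite ler_wpM2l// mulr_ge0//; lra.
have h3 : 8 * D * t <= 8 * D * t * (U * U ^+ q).
  by rewrite ler_peMr//; apply: mulr_ge0 => //; rewrite mulr_ge0.
rewrite /lip_const exprS.
move: bT h2 h3; move: (U * U ^+ q) ((2 * K1 + 5) ^+ q) (q.+1%:R) => W S' Q.
move: (b * eT) ((b - a) / a * exy) hx => e1 e2 *; lra.
Qed.

Lemma r_diff s a b : invariant s -> 0 < a -> a < b -> b <= 2 * a ->
  `|r s b - r s a| <= lip_const * D * ((b - a) / b) * (1 + X b) ^+ q.+1.
Proof.
move=> inv a0 ab b2a; have b0 := lt_trans a0 ab.
have K0 : 0 <= K1 * D by rewrite mulr_ge0// (le_trans _ radius_const_ge6).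
have Xab : 1 + X a <= 1 + X b.
  have LD : 0 <= L * D ^+ q by rewrite mulr_ge0 ?exprn_ge0// ltW.
  by rewrite lerD2l -!mulrA ler_wpM2r// ltW.
apply: (le_trans (dist_enorm_le _ _ _ _)).
apply: (@r_diff_arith a b _ (enorm (h s b - h s a)) _ (r s a) (enorm (x s a - h s b)) _ _
  a0 ab b2a (y_diff inv a0 ab) _ _ _ _ _ (x_diff s a0 ab)).
- by rewrite enorm_ge0 h_diff.
- by rewrite enorm_ge0 (le_trans (x_y_bound inv a0))// ler_wpM2l.
- by rewrite enorm_ge0 (le_trans (radius_bound inv a0))// ler_wpM2l.
- by rewrite enorm_ge0/= (enormB (h s b)) enorm_distD.
- exact: (model_center_lipschitz CF L_gt0 LF).
Qed.

Definition gap_const : R :=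
  5 * q.+2%:R * (q%:R * K1 ^+ q.-1 * lip_const + K1 ^+ q).

Lemma gap_const_ge2 : 2 <= gap_const.
Proof.
have K6 := radius_const_ge6.
have h1 : 1 <= K1 ^+ q by rewrite exprn_ege1//; lra.
have h2 : 1 <= q.+2%:R :> R by rewrite ler1n.
have h3 : 0 <= lip_const.
  by rewrite /lip_const !addr_ge0 ?mulr_ge0 ?exprn_ge0 ?ler0n//; lra.
have h4 : 0 <= q%:R * K1 ^+ q.-1 * lip_const.
  by rewrite !mulr_ge0 ?exprn_ge0 ?ler0n//; lra.
by rewrite /gap_const; nra.
Qed.

(** Splits b rb^q - a ra^q into b (rb^q - ra^q) + (b - a) ra^q. The powers of U = 1 + X b are q - 1
    from the radius, q + 1 from its variation, and one more from X b <= U. *)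
Lemma merit_gap_arith (a b ra rb : R) : 0 < a -> a < b ->
  0 <= ra <= K1 * D * (1 + X b) -> 0 <= rb <= K1 * D * (1 + X b) ->
  `|rb - ra| <= lip_const * D * ((b - a) / b) * (1 + X b) ^+ q.+1 ->
  5^-1 <= q.+2%:R * L * (b * rb ^+ q - a * ra ^+ q) ->
  1 <= gap_const * ((b - a) / b) * (1 + X b) ^+ (2 * q).+1.
Proof.
move=> a0 ab hra hrb rd c0; have b0 : 0 < b by lra.
have K6 := radius_const_ge6; have D0 := D_ge0.
have Xb0 := X_ge0 (ltW b0).
set t := (b - a) / b in rd *.
have t0 : 0 <= t by rewrite divr_ge0//; lra.
set U := 1 + X b in rd hra hrb *; have U1 : 1 <= U by rewrite /U lerDl.
set m := K1 * D * U in hra hrb; have m0 : 0 <= m by rewrite !mulr_ge0//; lra.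
have rq : rb ^+ q - ra ^+ q <= q%:R * m ^+ q.-1 * (lip_const * D * t * U ^+ q.+1).
  apply: (le_trans (ler_norm _)); apply: (le_trans (ler_dist_pow _ hrb hra)).
  by rewrite ler_wpM2l// mulr_ge0 ?ler0n ?exprn_ge0.
have raq : ra ^+ q <= m ^+ q.
  by move: hra => /andP[? ?]; rewrite lerXn2r ?nnegrE.
have Q0 : 0 < q.+2%:R :> R by rewrite ltr0n.
have E : q.+2%:R * L * (b * rb ^+ q - a * ra ^+ q) =
    q.+2%:R * (b * L * (rb ^+ q - ra ^+ q) + t * (b * L) * ra ^+ q).
  have -> : t * (b * L) = (b - a) * L by rewrite /t mulrA divfK// gt_eqF.
  by ring.
have bL0 : 0 <= b * L by rewrite mulr_ge0 ?ltW.
have k1 := ler_wpM2l bL0 rq; have k2 := ler_wpM2l (mulr_ge0 t0 bL0) raq.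
have e1 : b * L * (q%:R * m ^+ q.-1 * (lip_const * D * t * U ^+ q.+1)) =
    q%:R * K1 ^+ q.-1 * lip_const * t * (X b * U ^+ (2 * q)).
  have -> : (2 * q)%N = (q.-1 + q.+1)%N by rewrite addnS -addSn prednK// mul2n addnn.
  have -> : D ^+ q = D * D ^+ q.-1 by rewrite -exprS prednK.
  by rewrite /m !exprMn exprD; ring.
have e2 : t * (b * L) * m ^+ q = K1 ^+ q * t * (X b * U ^+ q).
  by rewrite /m !exprMn; ring.
have UX : X b <= U by rewrite /U; lra.
have V1 : X b * U ^+ (2 * q) <= U ^+ (2 * q).+1.
  by rewrite exprS ler_wpM2r// exprn_ge0//; lra.
have V2 : X b * U ^+ q <= U ^+ (2 * q).+1.
  rewrite exprS ler_pM ?exprn_ge0//; first by lra.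
  by rewrite ler_weXn2l// leq_pmull.
rewrite e1 in k1; rewrite e2 in k2.
have lip0 : 0 <= lip_const.
  by rewrite /lip_const !addr_ge0 ?mulr_ge0 ?exprn_ge0 ?ler0n//; lra.
have K0 n : 0 <= K1 ^+ n by rewrite exprn_ge0//; lra.
have w1 : 0 <= q%:R * K1 ^+ q.-1 * lip_const * t.
  exact: mulr_ge0 (mulr_ge0 (mulr_ge0 (ler0n _ _) (K0 _)) lip0) t0.
have w2 : 0 <= K1 ^+ q * t := mulr_ge0 (K0 q) t0.
have k3 := le_trans k1 (ler_wpM2l w1 V1); have k4 := le_trans k2 (ler_wpM2l w2 V2).
have := lerD k3 k4 => /(ler_wpM2l (ltW Q0)); rewrite -E => k5.
have := le_trans c0 k5.
have -> : q.+2%:R * (q%:R * K1 ^+ q.-1 * lip_const * t * U ^+ (2 * q).+1 +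
  K1 ^+ q * t * U ^+ (2 * q).+1) = gap_const / 5 * t * U ^+ (2 * q).+1.
  by rewrite /gap_const; field.
move: (U ^+ (2 * q).+1) => W; lra.
Qed.

(** 1/5 is 7/10 - 1/2, from rho >= 7/10 and p! >= 1. *)
Lemma threshold_gap (u v : R) : u < q.+1`!%:R * rho / Num.sqrt 2 ->
  q.+1`!%:R * rho < v -> 5^-1 <= v - u.
Proof.
have /andP[rh _] := @rho_bounds R.
have f1 : 1 <= q.+1`!%:R :> R by rewrite ler1n fact_gt0.
by rewrite -mulrA rho_div_sqrt2; nra.
Qed.

Lemma merit_gap s a b : invariant s -> 0 < a -> a < b -> b <= 2 * a ->
  merit_below s a -> merit_above s b ->
  1 <= gap_const * ((b - a) / b) * (1 + X b) ^+ (2 * q).+1.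
Proof.
move=> inv a0 ab b2a pa pb; have b0 := lt_trans a0 ab.
have K6 := radius_const_ge6.
have Xab : X a <= X b.
  have LD : 0 <= L * D ^+ q by rewrite mulr_ge0 ?exprn_ge0// ltW.
  by rewrite -!mulrA ler_wpM2r// ltW.
apply: (merit_gap_arith a0 ab _ _ (r_diff inv a0 ab b2a)).
- rewrite enorm_ge0/=; apply: (le_trans (radius_bound inv a0)).
  by rewrite ler_wpM2l ?lerD2l// mulr_ge0// (le_trans _ K6).
- by rewrite enorm_ge0 radius_bound.
have := threshold_gap pa pb; rewrite /merit MpE => /le_trans; apply.
have gen (c u v : R) : c * b * u - c * a * v <= c * (b * u - a * v).
  by rewrite mulrBr !mulrA.
exact: gen.
Qed.

(** For b <= 2 a, multiply [merit_gap] by X b. Otherwise, which includes a = 0, X (b - a) >= X b / 2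
    and [merit_large] suffices. *)
Lemma bracket_width s a b : invariant s -> 0 <= a -> a < b ->
  merit_below s a -> merit_above s b ->
  low_const <= gap_const * X (b - a) * (1 + X b) ^+ (2 * q).+1.
Proof.
move=> inv a0 ab pa pb; have b0 : 0 < b by lra.
have G2 := gap_const_ge2; have Xb0 := X_ge0 (ltW b0).
have low := merit_large inv b0 pb; have low0 := low_const_gt0.
have U1 : 1 <= (1 + X b) ^+ (2 * q).+1 by rewrite exprn_ege1// lerDl.
have LD : 0 <= L * D ^+ q by rewrite mulr_ge0 ?exprn_ge0// ltW.
have [b2a|b2a] := lerP b (2 * a).
  have a0' : 0 < a by lra.
  have := merit_gap inv a0' ab b2a pa pb => /(ler_wpM2l Xb0).
  have -> : X b * (gap_const * ((b - a) / b) * (1 + X b) ^+ (2 * q).+1) =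
      gap_const * X (b - a) * (1 + X b) ^+ (2 * q).+1.
    by field; rewrite gt_eqF.
  by rewrite mulr1; apply: le_trans.
have half : X b / 2 <= X (b - a).
  have : b / 2 <= b - a by lra.
  by move=> /(ler_wpM2r LD); rewrite !mulrA => h1; lra.
have h2 : low_const <= gap_const * X (b - a) by nra.
apply: (le_trans h2); rewrite ler_peMr//; apply: le_trans h2; exact: ltW.
Qed.

(** * The upper trial value and the number of trials *)

Definition kappa : R := L * D ^+ q.+1 / eps.

Lemma kappa_ge0 : 0 <= kappa.
Proof. by rewrite /kappa divr_ge0 ?mulr_ge0 ?exprn_ge0// ltW. Qed.

Definition upper_const : R := 4 ^+ q * q.+1`!%:R.

(** A |w| <= 2 D bounds the first branch of the maximum by 4 kappa. For the second, p-th powers are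
    compared, which removes the roots and leaves a constant times kappa^q. *)
Lemma upper_trial_bound s : invariant s ->
  X (upper_trial q.+1 F L eps s) <= upper_const * (1 + kappa).
Proof.
move=> inv; have k0 := kappa_ge0; have D0 := D_ge0.
have LD : 0 <= L * D ^+ q by rewrite mulr_ge0 ?exprn_ge0// ltW.
have f1 : 1 <= q.+1`!%:R :> R by rewrite ler1n fact_gt0.
have q4 : 4 <= 4 ^+ q :> R by rewrite -{1}[4]expr1 ler_weXn2l ?ler1n.
have C4 : 4 <= upper_const by rewrite /upper_const; nra.
have C0 : 0 <= upper_const * (1 + kappa) by rewrite mulr_ge0//; lra.
rewrite -mulrA /upper_trial maxr_pMl// ge_max; apply/andP; split.
  have := invariant_residual inv; rewrite /residual => iR.
  have iR' : 2 * st_A s * enorm (w s) / eps <= 4 * D / eps.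
    by rewrite ler_pM2r ?invr_gt0//; lra.
  apply: (le_trans (ler_wpM2r LD iR')).
  have -> : 4 * D / eps * (L * D ^+ q) = 4 * kappa by rewrite /kappa exprS; ring.
  nra.
set u := powR _ _.
have M0 : 0 < Mp q.+1 L by rewrite MpE mulr_gt0 ?ltr0n.
have /andP[rh0 rh1] := @rho_bounds R.
have g0 : 0 <= q.+1`!%:R * rho / Mp q.+1 L.
  by rewrite divr_ge0 ?mulr_ge0 ?(ltW M0)//; lra.
have qn0 : q%:R != 0 :> R by rewrite pnatr_eq0 -lt0n.
have uP : u ^+ q.+1 = (2 * (1 + rho) / eps) ^+ q * (q.+1`!%:R * rho / Mp q.+1 L).
  rewrite -powR_mulrn ?powR_ge0// /u -powRrM divfK ?pnatr_eq0//=.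
  rewrite powR_mulrn; last by rewrite mulr_ge0 ?powR_ge0// divr_ge0 ?mulr_ge0 ?ltW//; lra.
  rewrite exprMn; congr (_ * _).
  by rewrite -powR_mulrn ?powR_ge0// -powRrM mulVf// powRr1.
have uL0 : 0 <= u * (L * D ^+ q) by rewrite mulr_ge0// powR_ge0.
rewrite -(@ler_pXn2r _ q.+1)// ?nnegrE//.
rewrite exprMn uP.
have -> : (2 * (1 + rho) / eps) ^+ q * (q.+1`!%:R * rho / Mp q.+1 L) * (L * D ^+ q) ^+ q.+1 =
    (2 * (1 + rho)) ^+ q * (q.+1`!%:R * rho / q.+2%:R) * kappa ^+ q.
  have En : eps ^+ q != 0 by rewrite expf_neq0// gt_eqF.
  have Ln : L != 0 by rewrite gt_eqF.
  have Qn : q.+2%:R != 0 :> R by rewrite pnatr_eq0.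
  rewrite MpE /kappa !exprMn [L ^+ q.+1]exprS -!exprM [(q.+1 * q)%N]mulnC exprVn.
  move: (q.+2%:R) Qn => Q Qn; by field; rewrite En Ln Qn.
have a1 : (2 * (1 + rho)) ^+ q <= 4 ^+ q :> R.
  by rewrite lerXn2r ?nnegrE//; lra.
have a2 : q.+1`!%:R * rho / q.+2%:R <= q.+1`!%:R :> R.
  rewrite ler_pdivrMr ?ltr0n// ler_wpM2l ?ler0n// (le_trans rh1)// ler1n//.
have a3 : (2 * (1 + rho)) ^+ q * (q.+1`!%:R * rho / q.+2%:R) <= upper_const.
  by apply: ler_pM => //; rewrite ?exprn_ge0 ?divr_ge0 ?mulr_ge0 ?ler0n//; lra.
have a4 : kappa ^+ q <= (1 + kappa) ^+ q.+1.
  apply: (@le_trans _ _ ((1 + kappa) ^+ q)).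
    by rewrite lerXn2r ?nnegrE//; lra.
  by rewrite ler_weXn2l//; lra.
rewrite [(upper_const * _) ^+ _]exprMn; apply: ler_pM => //.
- by rewrite mulr_ge0 ?exprn_ge0 ?divr_ge0 ?mulr_ge0 ?ler0n//; lra.
- by rewrite exprn_ge0.
- by apply: (le_trans a3); rewrite -{1}[upper_const]expr1 ler_weXn2l//; lra.
Qed.

(** A rejected trial halves the bracket and keeps one end on each side of the acceptance window, so
    the width bound [delta] limits the number of rejections. *)
Lemma bisection_stops s (delta top : R) :
  (forall lo hi, 0 <= lo -> lo < hi -> hi <= top ->
    merit_below s lo -> merit_above s hi ->
    delta <= hi - lo) ->
  forall N lo hi, 0 <= lo -> lo < hi -> hi <= top ->
    merit_below s lo -> merit_above s hi ->
    hi - lo < 2 ^+ N * delta ->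
  exists n a, bisection q.+1 F H L z0 s lo hi n a /\ (n <= N)%N.
Proof.
move=> width; elim=> [|N IH] lo hi lo0 lohi hitop plo phi hl.
  by have := width lo hi lo0 lohi hitop plo phi; rewrite expr0 mul1r in hl; lra.
have m1 : lo < mid lo hi by rewrite /mid; lra.
have m2 : mid lo hi < hi by rewrite /mid; lra.
rewrite exprS in hl.
have [pm|pm] := ltP (psi s (mid lo hi)) (q.+1`!%:R * rho / Num.sqrt 2).
  have [||||||n [a [hb nN]]] := IH (mid lo hi) hi => //; try by rewrite /mid; lra.
  by exists n.+1, a; split => //; exact: Bisection_raise.
have [pm'|pm'] := ltP (q.+1`!%:R * rho) (psi s (mid lo hi)).
  have [||||||n [a [hb nN]]] := IH lo (mid lo hi) => //; try by rewrite /mid; lra.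
  by exists n.+1, a; split => //; exact: Bisection_lower.
by exists 1%N, (mid lo hi); split => //; apply: Bisection_accept; rewrite pm.
Qed.

(** Factor independent of kappa in the bound on the ratio of the initial bracket to the smallest
    possible one. *)
Definition trial_base : R := gap_const / low_const * (1 + upper_const) ^+ (2 * q).+2.

Lemma trial_base_ge1 : 1 <= trial_base.
Proof.
have G2 := gap_const_ge2; have l0 := low_const_gt0.
have l1 : low_const <= 1.
  have K6 := radius_const_ge6.
  rewrite /low_const invf_le1; last first.
    by rewrite mulr_gt0 ?mulr_gt0 ?exprn_gt0 ?ltr0n//; lra.
  rewrite -[1]mulr1 ler_pM// ?exprn_ege1//; last by lra.
  have : 1 <= q.+2%:R :> R by rewrite ler1n.
  by lra.
have u0 : 0 <= upper_const by rewrite mulr_ge0 ?exprn_ge0 ?ler0n.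
rewrite /trial_base -[1]mulr1 ler_pM// ?exprn_ege1//; last by lra.
by rewrite ler_pdivlMr//; lra.
Qed.

Lemma line_search_stops s N : invariant s ->
  trial_base * (1 + kappa) ^+ (2 * q).+2 < 2 ^+ N ->
  exists n o, line_search q.+1 F H L eps z0 s n o /\ (n <= N.+1)%N.
Proof.
move=> inv hN; set top := upper_trial q.+1 F L eps s.
have top0 : 0 < top := upper_trial_gt0 s.
have [pt|pt] := lerP (psi s top) (q.+1`!%:R * rho).
  exists 1%N, (Terminate (x s top)); split => //.
  exact: Line_search_terminate.
(* The factor a makes the merit vanish at 0, whatever value [z_next] takes there. *)
have p0 : merit_below s 0.
  by rewrite /merit_below /merit mulr0 mul0r divr_gt0 ?mulr_gt0 ?ltr0n
    ?fact_gt0 ?rho_gt0 ?sqrtr_gt0.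
rewrite -/(merit_above s top) in pt.
have G2 := gap_const_ge2; have l0 := low_const_gt0; have k0 := kappa_ge0.
have XT := merit_large inv top0 pt; have XU := upper_trial_bound inv.
rewrite -/top in XU.
have Xtop0 : 0 < X top by lra.
(* A merit above the threshold excludes D = 0, so [delta] has a nonzero denominator. *)
have LD : 0 < L * D ^+ q.
  by move: Xtop0; rewrite -mulrA pmulr_rgt0.
pose U := 1 + X top; have U1 : 1 <= U by rewrite /U; lra.
have den0 : 0 < gap_const * (L * D ^+ q) * U ^+ (2 * q).+1.
  by apply: mulr_gt0; [apply: mulr_gt0 => //; lra|rewrite exprn_gt0//; lra].
pose delta := low_const / (gap_const * (L * D ^+ q) * U ^+ (2 * q).+1).
have width lo hi : 0 <= lo -> lo < hi -> hi <= top ->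
    merit_below s lo -> merit_above s hi ->
    delta <= hi - lo.
  move=> lo0 lohi hitop plo phi.
  have := bracket_width inv lo0 lohi plo phi => h1.
  rewrite /delta ler_pdivrMr//; apply: (le_trans h1).
  have hi0 : 0 <= hi by lra.
  have Xh := X_ge0 hi0.
  have XX : X hi <= X top by rewrite -!mulrA ler_wpM2r// ltW.
  have UU : (1 + X hi) ^+ (2 * q).+1 <= U ^+ (2 * q).+1.
    by rewrite lerXn2r ?nnegrE /U; lra.
  have c0 : 0 <= gap_const * X (hi - lo) by rewrite mulr_ge0 ?X_ge0//; lra.
  apply: (le_trans (ler_wpM2l c0 UU)).
  by rewrite le_eqVlt; apply/orP; left; apply/eqP; ring.
have hN' : top - 0 < 2 ^+ N * delta.
  rewrite subr0 /delta mulrA ltr_pdivlMr//.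
  have -> : top * (gap_const * (L * D ^+ q) * U ^+ (2 * q).+1) =
    gap_const * (X top * U ^+ (2 * q).+1) by ring.
  have h1 : X top * U ^+ (2 * q).+1 <= U ^+ (2 * q).+2.
    by rewrite [leRHS]exprS ler_wpM2r ?exprn_ge0 /U//; lra.
  have u0 : 0 <= upper_const by rewrite mulr_ge0 ?exprn_ge0 ?ler0n.
  have h2 : U ^+ (2 * q).+2 <= ((1 + upper_const) * (1 + kappa)) ^+ (2 * q).+2.
    rewrite lerXn2r ?nnegrE ?mulr_ge0//; try lra.
    by rewrite /U; nra.
  have G0 : 0 <= gap_const by lra.
  apply: (le_lt_trans (ler_wpM2l G0 (le_trans h1 h2))).
  rewrite -ltr_pdivrMr//; apply: le_lt_trans hN.
  by rewrite exprMn /trial_base le_eqVlt; apply/orP; left; apply/eqP; ring.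
have [n [a [hb nN]]] := bisection_stops width (lexx 0) top0 (lexx top) p0 pt hN'.
by exists n.+1, (Accept a); split => //; exact: Line_search_bisect.
Qed.

End Algorithm.

(** * From a power of two to a logarithmic bound *)

Lemma expR_half_le2 {R : realType} : expR (2^-1 : R) <= 2.
Proof.
have h := expR_ge1Dx (- 2^-1 : R).
rewrite -(invrK (expR _)) -expRN -[leRHS]invrK lef_pV2 ?posrE ?expR_gt0 ?invr_gt0//.
by apply: le_trans h; lra.
Qed.

Unset Implicit Arguments.
Set Strict Implicit.

Theorem theorem5p3 (R : realType) (p : nat) (hp : (2 <= p)%N) :
  exists C : R, 0 < C /\
  forall (d : nat) (F : 'rV[R]_d -> 'rV[R]_d) (H : 'rV[R]_d -> set 'rV[R]_d)
    (L eps : R) (zstar z0 : 'rV[R]_d),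
    monotone_op (fun z => [set F z]) ->
    continuously_differentiable p.-1 F ->
    0 < L ->
    (forall z z',
       (op_norm (fun hs : p.-1.-tuple 'rV[R]_d =>
                   (iter_diff F hs z - iter_diff F hs z')%R)
        <= (L * enorm (z - z'))%:E)%E) ->
    maximal_monotone H ->
    (exists2 v, H zstar v & F zstar + v = 0) ->
    dom H z0 ->
    0 < eps ->
    forall (k : nat) (s : state),
      line_search_invoked p F H L eps z0 k s ->
      exists (n : nat) (o : outcome),
        line_search p F H L eps z0 s n o /\
        n%:R <= C * (1 + ln (1 + L * enorm (z0 - zstar) ^+ p / eps)).
Proof.
have arith (b e l n N : R) : 0 <= b -> 0 <= e -> 0 <= l -> n <= N + 1 ->
    N <= 2 * (b + e * l) + 1 -> n <= (2 * b + 2 * e + 2) * (1 + l).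
  by move=> b0 e0 l0 nN Nt; have := mulr_ge0 b0 l0; lra.
case: p hp => [//|q] hq; have q_gt0 : (0 < q)%N by [].
(* [trial_base] involves only q, so the constant is fixed before the dimension and the data. *)
pose B := @trial_base R q; pose E := (2 * q).+2.
have B1 : 1 <= B by exact: trial_base_ge1.
have lnB : 0 <= ln B by rewrite ln_ge0.
exists (2 * ln B + 2 * E%:R + 2); split.
  by rewrite ltr_wpDl// addr_ge0// mulr_ge0// ler0n.
move=> d F H L eps zstar z0 mono CF L0 LF maxH [v Hv Fv] dz0 e0 k s hs.
have zH : H zstar (- F zstar).
  by rewrite -(addKr (F zstar) v) Fv addr0 in Hv.
have inv := reached_invariant q_gt0 mono CF L0 LF maxH zH e0 (invoked_reached hs).
set kap := L * _ / eps.
have k0 : 0 <= kap by rewrite divr_ge0 ?mulr_ge0 ?exprn_ge0 ?enorm_ge0// ltW.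
pose l := ln (1 + kap); have l0 : 0 <= l by rewrite ln_ge0// lerDl.
(* Since exp(1/2) <= 2, any N > t gives 2^N >= exp(N / 2) > B (1 + kap)^E; the factor 2 stands in
   for 1 / ln 2. *)
pose t := 2 * (ln B + E%:R * l).
have t0 : 0 <= t by rewrite mulr_ge0// addr_ge0// mulr_ge0// ler0n.
pose N := (Num.trunc t).+1.
have tN : t < N%:R := truncnS_gt t.
have Nt : N%:R <= t + 1.
  by rewrite /N -natr1 lerD2r; have /andP[] := truncn_itv t0.
have hN : B * (1 + kap) ^+ E < 2 ^+ N.
  have B0 : B \is Num.pos by rewrite posrE; lra.
  have k1 : 1 + kap \is Num.pos by rewrite posrE; lra.
  rewrite -[B]lnK// -[X in X ^+ E]lnK// -expRM_natl -expRD.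
  apply: (@lt_le_trans _ _ (expR (2^-1) ^+ N)).
    by rewrite -expRM_natl ltr_expR -/l; rewrite /t in tN; lra.
  by rewrite lerXn2r ?nnegrE ?expR_ge0// expR_half_le2.
have [n [out [hls nN]]] := line_search_stops q_gt0 mono CF L0 LF maxH zH e0 inv hN.
exists n, out; split => //; rewrite -/l.
by apply: (arith _ _ _ _ N%:R) => //; rewrite natr1 ler_nat.
Qed.
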